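(* Assume $N:=-\lambda_1-\alpha_1\in\mathbb{Z}_{\ge0}$, $\beta<1$, $\alpha_2-\alpha_1<1$, $t_1>0$, $t_2>0$, $h_1<h_2$, $l_1<l_2$, and moreover $1+h_2-l_2-\beta>0$ and $2+2h_2-l_1-l_2-\beta>0$. Let $c_n(E)$ be the polynomials in $E$ defined in the context. Let $k\in\{1,2,\dots,N+1\}$ and let $E_k=E_k(q)$ (defined for sufficiently small $q>0$) be a solution of $c_{N+1}(E)=0$ such that $E_k\sim -q^{3/2-k+h_1-\lambda_1}t_1$. (i) The coefficients of the normalized polynomial-type solution $x^{\lambda_1}\sum_{n=0}^N c_n(E_k)x^n$ of the $q$-Heun equation with $E=E_k$ satisfy $$c_n(E_k)\sim -q^{n-k+1/2-h_2}\,t_2^{-1}\,c_{n-1}(E_k)\quad(1\le n\le k-1),$$ $$c_n(E_k)\sim q^{2n+1/2+h_2-l_1-l_2-\beta}\,t_1^{-1}\,c_{n-1}(E_k)\quad(k\le n\le N).$$ (ii) As polynomials in $x$, $$\sum_{n=0}^N c_n(E_k)x^n\sim\prod_{j=1}^{k-1}\left(1-q^{j-k+1/2-h_2}t_2^{-1}x\right)\prod_{j=k}^N\left(1+q^{2j+1/2+h_2-l_1-l_2-\beta}t_1^{-1}x\right).$$ (iii) For each $j=1,2,\dots,N$ there exists $q_j\in\mathbb{R}_{>0}$ such that the polynomial $\sum_{n=0}^N c_n(E_k)x^n$ has a zero $x=x_j(q)$ for $0<q<q_j$ which is continuous in $q$ and satisfies $$\lim_{q\to+0}\frac{x_j(q)}{q^{j-1/2+h_2}\,t_2}=1\quad(j=1,\dots,k-1),$$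 $$\lim_{q\to+0}\frac{x_j(q)}{-q^{-2j-1/2-h_2+l_1+l_2+\beta}\,t_1}=1\quad(j=k,\dots,N).$$
   Context: The parameters $t_1,t_2,h_1,h_2,l_1,l_2,\alpha_1,\alpha_2,\beta$ are fixed real numbers independent of $q$, and $0<q<1$ is a variable. Set $\lambda_1=(h_1+h_2-l_1-l_2-\alpha_1-\alpha_2-\beta+2)/2$. The $q$-Heun equation with accessory parameter $E$ is $$(x-q^{h_1+1/2}t_1)(x-q^{h_2+1/2}t_2)\,g(x/q)+q^{\alpha_1+\alpha_2}(x-q^{l_1-1/2}t_1)(x-q^{l_2-1/2}t_2)\,g(qx)$$ $$-\{(q^{\alpha_1}+q^{\alpha_2})x^2+Ex+q^{(h_1+h_2+l_1+l_2+\alpha_1+\alpha_2)/2}(q^{\beta/2}+q^{-\beta/2})t_1t_2\}\,g(x)=0 .$$ The polynomials $c_n(E)$ are defined by $c_{-1}(E)=0$, $c_0(E)=1$ and, for $n=1,\dots,N+1$, $$c_n(E)\,t_1t_2q^{h_1+h_2}(1-q^n)(1-q^{n-\beta})=c_{n-1}(E)\Big[Eq^{n-1+\lambda_1}+q^{1/2}(q^{h_1}t_1+q^{h_2}t_2)+(q^{l_1}t_1+q^{l_2}t_2)q^{2(n-1+\lambda_1)+\alpha_1+\alpha_2-1/2}\Big]$$ $$-c_{n-2}(E)\,q\,(1-q^{n-2+\lambda_1+\alpha_1})(1-q^{n-2+\lambda_1+\alpha_2}).$$ If $c_{N+1}(E_k)=0$, then $x^{\lambda_1}\sum_{n=0}^N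 c_n(E_k)x^n$ solves the $q$-Heun equation with $E=E_k$; ''normalized'' refers to $c_0(E_k)=1$. For functions of $q$: $a(q)\sim b(q)$ means $\lim_{q\to+0}a(q)/b(q)=1$. For polynomials in a variable with $q$-dependent coefficients, $\sim$ means that corresponding coefficients are equivalent in this sense. Empty products equal $1$. *)

(* Defs.v *)
From HB Require Import structures.
From mathcomp Require Import all_boot all_order all_algebra.
From mathcomp Require Import all_classical all_reals all_analysis.

Set Implicit Arguments.
Unset Strict Implicit.
Unset Printing Implicit Defensive.

Import Order.TTheory GRing.Theory Num.Theory.
Import numFieldNormedType.Exports.

Local Open Scope classical_set_scope.
Local Open Scope ring_scope.

Record qHeun_params (R : realType) := QHeunParams {
  t1 : R; t2 : R; h1 : R; h2 : R; l1 : R; l2 : R;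
  alpha1 : R; alpha2 : R; beta : R }.

Definition lambda1 (R : realType) (p : qHeun_params R) : R :=
  (h1 p + h2 p - l1 p - l2 p - alpha1 p - alpha2 p - beta p + 2) / 2.

(* Imposed for x > 0 only, where the real power x^(lambda1) is defined. *)
Definition qHeun_solution (R : realType) (p : qHeun_params R) (q E : R)
    (g : R -> R) : Prop :=
  forall x : R, 0 < x ->
    (x - q `^ (h1 p + 1 / 2) * t1 p) * (x - q `^ (h2 p + 1 / 2) * t2 p)
      * g (x / q)
    + q `^ (alpha1 p + alpha2 p)
      * (x - q `^ (l1 p - 1 / 2) * t1 p) * (x - q `^ (l2 p - 1 / 2) * t2 p)
      * g (q * x)
    - ((q `^ alpha1 p + q `^ alpha2 p) * x ^+ 2 + E * x
       + q `^ ((h1 p + h2 p + l1 p + l2 p + alpha1 p + alpha2 p) / 2)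
         * (q `^ (beta p / 2) + q `^ (- (beta p / 2))) * t1 p * t2 p)
      * g x = 0.

(* The three coefficients of the recurrence
   lead n * c_n = c_(n-1) * mid n - c_(n-2) * low n. *)
Definition lead_rec (R : realType) (p : qHeun_params R) (q : R) (n : nat) : R :=
  t1 p * t2 p * q `^ (h1 p + h2 p) * (1 - q ^+ n) * (1 - q `^ (n%:R - beta p)).

Definition mid_rec (R : realType) (p : qHeun_params R) (q : R) (n : nat) :
    {poly R} :=
  q `^ (n%:R - 1 + lambda1 p) *: 'X
  + (q `^ (1 / 2) * (q `^ h1 p * t1 p + q `^ h2 p * t2 p)
     + (q `^ l1 p * t1 p + q `^ l2 p * t2 p)
       * q `^ (2 * (n%:R - 1 + lambda1 p) + alpha1 p + alpha2 p - 1 / 2))%:P.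

Definition low_rec (R : realType) (p : qHeun_params R) (q : R) (n : nat) : R :=
  q * (1 - q `^ (n%:R - 2 + lambda1 p + alpha1 p))
    * (1 - q `^ (n%:R - 2 + lambda1 p + alpha2 p)).

(* Polynomials in E. The division is legitimate when 0 < q < 1, t1, t2 != 0
   and beta < 1, for then lead_rec p q n != 0 for all n >= 1. *)
Fixpoint c (R : realType) (p : qHeun_params R) (q : R) (n : nat) : {poly R} :=
  match n with
  | 0 => 1
  | m.+1 =>
      (lead_rec p q n)^-1 *:
        (c p q m * mid_rec p q n
         - low_rec p q n *: (match m with 0 => 0 | m'.+1 => c p q m' end))
  end.

Lemma c_rec1 (R : realType) (p : qHeun_params R) (q : R) :
  lead_rec p q 1 != 0 ->
  lead_rec p q 1 *: c p q 1 = c p q 0 * mid_rec p q 1.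
Proof. by move=> nz; rewrite /= scalerA divff// scale1r scaler0 subr0. Qed.

Lemma c_rec (R : realType) (p : qHeun_params R) (q : R) (n : nat) :
  lead_rec p q n.+2 != 0 ->
  lead_rec p q n.+2 *: c p q n.+2 =
  c p q n.+1 * mid_rec p q n.+2 - low_rec p q n.+2 *: c p q n.
Proof.
move=> nz.
have -> : c p q n.+2 = (lead_rec p q n.+2)^-1 *:
  (c p q n.+1 * mid_rec p q n.+2 - low_rec p q n.+2 *: c p q n) by [].
by rewrite scalerA divff// scale1r.
Qed.

Definition qHeun_poly (R : realType) (p : qHeun_params R) (N : nat) (q E : R) :
    {poly R} :=
  \sum_(0 <= n < N.+1) (c p q n).[E] *: 'X^n.

Definition sim (R : realType) (a b : R -> R) : Prop :=
  (a q / b q) @[q --> (0 : R)^'+] --> (1 : R).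

(* Equivalence of all corresponding coefficients, for polynomials of degree at
   most d; beyond d all the coefficients vanish and no quotient makes sense. *)
Definition poly_sim (R : realType) (d : nat) (P Q : R -> {poly R}) : Prop :=
  (\forall q \near (0 : R)^'+,
     (size (P q) <= d.+1)%N /\ (size (Q q) <= d.+1)%N) /\
  forall n, (n <= d)%N -> sim (fun q => (P q)`_n) (fun q => (Q q)`_n).

(* Main.v *)
Require Import Defs.
From HB Require Import structures.
From mathcomp Require Import all_boot all_order all_algebra.
From mathcomp Require Import all_classical all_reals all_analysis.
From mathcomp Require Import ring lra zify.
From mathcomp Require polyrcf.

Set Implicit Arguments.
Unset Strict Implicit.
Unset Printing Implicit Defensive.

Import Order.TTheory GRing.Theory Num.Theory.
Import numFieldNormedType.Exports.

Local Open Scope classical_set_scope.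
Local Open Scope ring_scope.

(** In the limit [q -> 0+] every coefficient of the recurrence is a power of
    [q] up to a constant, and all the assertions are dominant balances in it.

    Measure [E] in units of [- q^(3/2 - k + h1 - lambda1) t1].  In the middle
    coefficient of the recurrence at the index [n] the term in [E] dominates
    for [n < k], the constant [q^(1/2 + h1) t1] dominates for [n > k], and at
    [n = k] they have the same size and opposite signs; the term in
    [c_(n-2)] disappears in the limit.  Suitably normalized, the polynomial
    [c_n] thus tends, coefficient by coefficient, to [(-X)^n] for
    [n < k] and to [(-X)^(k-1) (1 - X)] for [n >= k] ([scaled_c_cvg]).  This
    gives the ratios [c_n / c_(n-1)] for [n < k].  It also shows that [E] is
    [root_scale] times a value close to the simple root 1 of the limit of
    [c_(N+1)].  Such a root persists as a unique continuous branch
    ([simple_root_branch]), so that [E] must be continuous near 0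
    ([root_continuous]); the last assertion depends on this.

    At [n = k] the two main terms cancel and the forward recurrence gives no
    information.  There the recurrence is followed backwards from
    [c_(N+1) = 0]: it is the term in [c_n] that is now negligible against the
    two others ([ratio_asymp_backward]), and the ratios for [n >= k] follow by
    descending induction.

    The exponents of the successive ratios increase strictly
    ([ratio_exp_lt]); in other words the Newton polygon of the polynomial
    [c_0 + c_1 x + ... + c_N x^N] is strictly convex, with edges of length
    one.  Hence this polynomial is equivalent to the product of the linear
    factors attached to the edges ([prod_linear_coef_asymp]).  In the scale of
    the [j]-th edge it tends to a multiple of [X^j (1 - X)], and
    [simple_root_branch] applies again and gives the zeros
    ([newton_polygon_branch]).

    That the q-Heun equation holds is an exact identity for each [q]: its
    effect on [x^(lambda1 + n)] involves the three coefficients of the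
    recurrence ([qHeun_monomial]), and the sum over [n] telescopes. *)

(** * Coefficientwise convergence of families of polynomials *)

Definition coef_cvg (R : realType) (T : Type) (F : set_system T)
    (P : T -> {poly R}) (Q : {poly R}) : Prop :=
  forall i, (P s)`_i @[s --> F] --> Q`_i.

Lemma cvg_sum_fun (R : realType) (T : Type) (F : set_system T) (I : Type)
    (r : seq I) (f : I -> T -> R) (l : I -> R) :
  Filter F -> (forall i, f i s @[s --> F] --> l i) ->
  (\sum_(i <- r) f i s) @[s --> F] --> \sum_(i <- r) l i.
Proof. by move=> FF fl; apply: cvg_big => //; exact: add_continuous. Qed.

Lemma cvg_exprn (R : realType) (T : Type) (F : set_system T) (f : T -> R)
    (l : R) (n : nat) :
  Filter F -> f s @[s --> F] --> l -> f s ^+ n @[s --> F] --> l ^+ n.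
Proof.
move=> FF fl; have cX : x ^+ n @[x --> l] --> l ^+ n by exact: exprn_continuous.
exact: (@cvg_comp _ _ _ f (fun x => x ^+ n) _ _ _ fl cX).
Qed.

Lemma coef_cvg_cst (R : realType) (T : Type) (F : set_system T) (Q : {poly R}) :
  Filter F -> coef_cvg F (fun=> Q) Q.
Proof. by move=> FF i; exact: cvg_cst. Qed.

Lemma coef_cvgD (R : realType) (T : Type) (F : set_system T)
    (P1 P2 : T -> {poly R}) (Q1 Q2 : {poly R}) :
  Filter F -> coef_cvg F P1 Q1 -> coef_cvg F P2 Q2 ->
  coef_cvg F (fun s => P1 s + P2 s) (Q1 + Q2).
Proof.
move=> FF c1 c2 i; rewrite coefD; under eq_cvg do rewrite coefD.
exact: cvgD.
Qed.

Lemma coef_cvgB (R : realType) (T : Type) (F : set_system T)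
    (P1 P2 : T -> {poly R}) (Q1 Q2 : {poly R}) :
  Filter F -> coef_cvg F P1 Q1 -> coef_cvg F P2 Q2 ->
  coef_cvg F (fun s => P1 s - P2 s) (Q1 - Q2).
Proof.
move=> FF c1 c2 i; rewrite coefB; under eq_cvg do rewrite coefB.
exact: cvgB.
Qed.

Lemma coef_cvgM (R : realType) (T : Type) (F : set_system T)
    (P1 P2 : T -> {poly R}) (Q1 Q2 : {poly R}) :
  Filter F -> coef_cvg F P1 Q1 -> coef_cvg F P2 Q2 ->
  coef_cvg F (fun s => P1 s * P2 s) (Q1 * Q2).
Proof.
move=> FF c1 c2 i; rewrite coefM; under eq_cvg do rewrite coefM.
by apply: cvg_sum_fun => j; exact: cvgM.
Qed.

Lemma coef_cvgZ (R : realType) (T : Type) (F : set_system T)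
    (u : T -> R) (l : R) (P : T -> {poly R}) (Q : {poly R}) :
  Filter F -> u s @[s --> F] --> l -> coef_cvg F P Q ->
  coef_cvg F (fun s => u s *: P s) (l *: Q).
Proof.
move=> FF ul cP i; rewrite coefZ; under eq_cvg do rewrite coefZ.
exact: cvgM.
Qed.

Lemma coef_cvg_polyC (R : realType) (T : Type) (F : set_system T)
    (u : T -> R) (l : R) :
  Filter F -> u s @[s --> F] --> l -> coef_cvg F (fun s => (u s)%:P) l%:P.
Proof.
move=> FF ul i; rewrite coefC; under eq_cvg do rewrite coefC.
by case: eqP => _ //; exact: cvg_cst.
Qed.

Lemma coef_cvg_deriv (R : realType) (T : Type) (F : set_system T)
    (P : T -> {poly R}) (Q : {poly R}) :
  Filter F -> coef_cvg F P Q -> coef_cvg F (fun s => (P s)^`()) Q^`().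
Proof.
move=> FF cP i; rewrite coef_deriv -mulr_natr.
under eq_cvg do rewrite coef_deriv -mulr_natr.
by apply: cvgM => //; exact: cvg_cst.
Qed.

(** A degree bound uniform in [s] is what turns coefficientwise convergence
    into convergence of values, the point of evaluation moving along. *)
Lemma coef_cvg_horner (R : realType) (T : Type) (F : set_system T) (d : nat)
    (P : T -> {poly R}) (Q : {poly R}) (z : T -> R) (a : R) :
  Filter F -> (forall s, (size (P s) <= d)%N) -> (size Q <= d)%N ->
  coef_cvg F P Q -> z s @[s --> F] --> a ->
  (P s).[z s] @[s --> F] --> Q.[a].
Proof.
move=> FF sP sQ cP za; rewrite (horner_coef_wide a sQ).
under eq_cvg do rewrite (horner_coef_wide _ (sP _)).
by apply: cvg_sum_fun => i; apply: cvgM => //; exact: cvg_exprn.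
Qed.

Lemma coef_dilation (R : comNzRingType) (P : {poly R}) (a : R) (i : nat) :
  (P \Po (a *: 'X))`_i = a ^+ i * P`_i.
Proof.
have -> : P \Po (a *: 'X) = \poly_(i < size P) (a ^+ i * P`_i).
  rewrite comp_polyE poly_def; apply: eq_bigr => j _.
  by rewrite exprZn scalerA mulrC.
rewrite coef_poly; case: ltnP => // sP.
by rewrite (nth_default _ sP) mulr0.
Qed.

(** * Continuous branches of a simple root *)

(** Values of opposite signs persist under coefficientwise convergence. *)
Lemma near_root_between (R : realType) (T : Type) (F : set_system T) (d : nat)
    (P : T -> {poly R}) (Q : {poly R}) (a e : R) :
  Filter F -> (forall s, (size (P s) <= d)%N) -> (size Q <= d)%N ->
  coef_cvg F P Q -> 0 < e -> Q.[a - e] < 0 -> 0 < Q.[a + e] ->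
  \forall s \near F, exists2 z, `|z - a| < e & root (P s) z.
Proof.
move=> FF sP sQ cP e0 Qneg Qpos.
have cv b := coef_cvg_horner FF sP sQ cP (@cvg_cst R b T F FF).
have pos := cvgr_gt (FF := FF) _ (cv (a + e)) _ Qpos.
have neg := cvgr_lt (FF := FF) _ (cv (a - e)) _ Qneg.
apply: filterS2 neg pos => s Pn Pp.
have le : a - e <= a + e by lra.
have [|z zI rz] := polyrcf.poly_ivtoo le (p := P s).
  by rewrite nmulr_rlt0.
exists z => //; move: zI; rewrite in_itv /= => /andP[z1 z2].
by rewrite ltr_norml; apply/andP; split; lra.
Qed.

(** Reduces statements near [0+] to explicit intervals, on which branches can
    be defined and continuity can be claimed. *)
Lemma near_right0P (R : realType) (A : R -> Prop) :
  (\forall q \near (0 : R)^'+, A q) <->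
  exists2 r, 0 < r & forall q, 0 < q < r -> A q.
Proof.
split=> [[r /= r0 rA]|[r r0 rA]].
  exists r => // q /andP[q0 qr]; apply: rA => //=.
  by rewrite sub0r normrN gtr0_norm.
exists r => // q /=; rewrite sub0r normrN => qr q0.
by apply: rA; rewrite q0 -[X in X < _](gtr0_norm q0).
Qed.

Definition increasing_near (R : realType) (Q : {poly R}) (a e : R) : Prop :=
  forall x y, `|x - a| < e -> `|y - a| < e -> x < y -> Q.[x] < Q.[y].

Lemma deriv_gt0_increasing_near (R : realType) (Q : {poly R}) (a e : R) :
  (forall z, `|z - a| < e -> 0 < Q^`().[z]) -> increasing_near Q a e.
Proof.
move=> dQ x y xa ya xy; have [z] := polyrcf.mvt Q xy.
rewrite in_itv /= => /andP[xz zy] eqQ.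
rewrite -subr_gt0 eqQ mulr_gt0 ?subr_gt0//; apply: dQ.
move: xa ya; rewrite !ltr_norml => /andP[? ?] /andP[? ?].
by apply/andP; split; lra.
Qed.

(** The only root close to [b] cannot stay away from [b]: sign changes at
    [b - eta] and [b + eta] catch a root, for every small [eta]. *)
Lemma unique_root_cvg (R : realType) (T : Type) (F : set_system T) (d : nat)
    (P : T -> {poly R}) (Q : {poly R}) (b e : R) (y : T -> R) :
  Filter F -> (forall s, (size (P s) <= d)%N) -> (size Q <= d)%N ->
  coef_cvg F P Q -> 0 < e -> increasing_near Q b e -> root Q b ->
  (\forall s \near F, forall z, `|z - b| < e -> root (P s) z -> z = y s) ->
  y s @[s --> F] --> b.
Proof.
move=> FF sP sQ cP e0 incQ rQ yP; apply/cvgrPdist_lt => eps eps0.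
pose eta := Num.min eps e / 2.
have m0 : 0 < Num.min eps e by rewrite lt_min eps0 e0.
have [m1 m2] : Num.min eps e <= eps /\ Num.min eps e <= e.
  by rewrite !ge_min !lexx orbT.
have eta0 : 0 < eta by rewrite /eta; lra.
have etae : eta < e by rewrite /eta; lra.
have etaeps : eta < eps by rewrite /eta; lra.
have bb : `|b - b| < e by rewrite subrr normr0.
have bl : `|b - eta - b| < e by rewrite ltr_norml; apply/andP; split; lra.
have br : `|b + eta - b| < e by rewrite ltr_norml; apply/andP; split; lra.
have Qb : Q.[b] = 0 by apply/rootP.
have Ql : Q.[b - eta] < 0 by rewrite -Qb; apply: incQ => //; lra.
have Qr : 0 < Q.[b + eta] by rewrite -Qb; apply: incQ => //; lra.
have exz := near_root_between FF sP sQ cP eta0 Ql Qr.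
apply: filterS2 yP exz => s ys [z zb rz].
by rewrite distrC -(ys z) // ?(lt_trans zb).
Qed.

(** The derivative converges jointly in the index and in the point, which
    makes the radius [e] uniform along the filter. *)
Lemma deriv_gt0_near (R : realType) (T : Type) (F : set_system T) (d : nat)
    (P : T -> {poly R}) (Q : {poly R}) (a : R) :
  Filter F -> (forall s, (size (P s) <= d)%N) -> (size Q <= d)%N ->
  coef_cvg F P Q -> 0 < Q^`().[a] ->
  exists2 e, 0 < e & \forall s \near F, increasing_near (P s) a e.
Proof.
move=> FF sP sQ cP Qa.
have dsz (S : {poly R}) : (size S <= d)%N -> (size S^`() <= d)%N.
  move=> sS; apply: leq_trans (size_poly _ _) _.
  exact: leq_trans (leq_pred _) sS.
have cD : coef_cvg (filter_prod F (nbhs a)) (fun w => (P w.1)^`()) Q^`().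
  by apply: coef_cvg_deriv => i; apply: cvg_comp (cP i); exact: cvg_fst.
have szD (w : T * R) : (size (P w.1)^`() <= d)%N by exact: dsz.
have FG : Filter (filter_prod F (nbhs a)) by exact: filter_prod_filter.
have cv := coef_cvg_horner FG szD (dsz _ sQ) cD (@cvg_snd _ _ F (nbhs a) FF).
have [[A B] /= [FA [e /= e0 eB]] AB] := cvgr_gt (FF := FG) _ cv _ Qa.
exists e => //; apply: filterS FA => s As.
apply: deriv_gt0_increasing_near => z za; apply: (AB (s, z)); split => //=.
by apply: eB; rewrite /= distrC.
Qed.

Lemma increasing_near_le (R : realType) (Q : {poly R}) (a e a' e' : R) :
  `|a' - a| + e' <= e -> increasing_near Q a e -> increasing_near Q a' e'.
Proof.
move=> le incQ x y xa ya; apply: incQ.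
  by rewrite (le_lt_trans (ler_distD a' _ _))//; lra.
by rewrite (le_lt_trans (ler_distD a' _ _))//; lra.
Qed.

Lemma increasing_near_root_inj (R : realType) (Q : {poly R}) (a e x y : R) :
  increasing_near Q a e -> `|x - a| < e -> `|y - a| < e ->
  root Q x -> root Q y -> x = y.
Proof.
move=> incQ xa ya /rootP rx /rootP ry.
case: (ltgtP x y) => // xy.
  by have := incQ _ _ xa ya xy; rewrite rx ry ltxx.
by have := incQ _ _ ya xa xy; rewrite rx ry ltxx.
Qed.

(** Implicit function theorem at the boundary parameter [q = 0+]: the limit
    polynomial has a simple root, which continues to a unique continuous
    branch.  Joint convergence of the derivative makes every [P q] strictly
    monotone on one fixed neighbourhood of the root; existence, uniqueness and
    continuity of the branch are then sign arguments. *)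
Lemma simple_root_branch (R : realType) (d : nat) (P : R -> {poly R})
    (Q : {poly R}) (a r0 : R) :
  0 < r0 -> (forall q, (size (P q) <= d)%N) -> (size Q <= d)%N ->
  (forall q, 0 < q < r0 -> coef_cvg (nbhs q) P (P q)) ->
  coef_cvg (0 : R)^'+ P Q -> root Q a -> Q^`().[a] != 0 ->
  exists (r e : R) (y : R -> R),
    [/\ 0 < r, 0 < e,
        forall q, 0 < q < r -> root (P q) (y q) /\ {for q, continuous y},
        forall q z, 0 < q < r -> `|z - a| < e -> root (P q) z -> z = y q
      & y q @[q --> (0 : R)^'+] --> a].
Proof.
move=> r00; pose k := Q^`().[a].
(* Multiplying by the slope reduces to the case of a positive slope. *)
wlog Qa : P Q @k / 0 < Q^`().[a] => [hw sP sQ cont cP rQ Qa|].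
  have szZ (S : {poly R}) : (size S <= d)%N -> (size (k *: S) <= d)%N.
    exact/leq_trans/size_scale_leq.
  have [|||||||] := hw (fun q => k *: P q) (k *: Q).
  - by rewrite derivZ hornerZ -expr2 exprn_even_gt0.
  - by move=> q; exact: szZ.
  - exact: szZ.
  - by move=> q qr; apply: coef_cvgZ; [exact: cvg_cst|exact: cont].
  - by apply: coef_cvgZ => //; exact: cvg_cst.
  - by rewrite rootZ.
  - by rewrite derivZ hornerZ mulf_neq0.
  move=> r [e [y [r0' e0 y1 y2 y3]]]; exists r, e, y; split => //.
    by move=> q /y1[]; rewrite rootZ.
  by move=> q z qr za rz; apply: y2 => //; rewrite rootZ.
move=> sP sQ cont cP rQ _.
have F0 := at_right_proper_filter (0 : R).
have [e1 e10 inc1] := deriv_gt0_near F0 sP sQ cP Qa.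
have [e2 e20 incQ2] : exists2 e, 0 < e & increasing_near Q a e.
  have := deriv_gt0_near (nbhs_filter (0 : R)) (fun=> sQ) sQ
    (coef_cvg_cst (nbhs_filter (0 : R))) Qa.
  by move=> [e e0 /nbhs_singleton incQ]; exists e.
pose e := Num.min e1 e2.
have e0 : 0 < e by rewrite lt_min e10 e20.
have [le1 le2] : e <= e1 /\ e <= e2 by rewrite !ge_min !lexx orbT.
have incQ : increasing_near Q a e.
  by apply: increasing_near_le incQ2; rewrite subrr normr0 add0r.
have /near_right0P[r1 r10 inc] := inc1.
have h0 : 0 < e / 2 by lra.
have inball b : `|b| < e -> `|a + b - a| < e by rewrite addrAC subrr add0r.
have aball : `|a - a| < e by rewrite subrr normr0.
have Qa0 : Q.[a] = 0 by apply/rootP.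
have Ql : Q.[a - e / 2] < 0.
  rewrite -Qa0; apply: incQ => //; last by lra.
  by rewrite inball ?normrN ?gtr0_norm//; lra.
have Qr : 0 < Q.[a + e / 2].
  by rewrite -Qa0; apply: incQ => //; [rewrite inball ?gtr0_norm//|]; lra.
have /near_right0P[r2 r20 ex] := near_root_between F0 sP sQ cP h0 Ql Qr.
pose r := Num.min r0 (Num.min r1 r2).
pose y q := xget a [set z | `|z - a| < e /\ root (P q) z].
have r_gt0 : 0 < r by rewrite !lt_min r00 r10 r20.
have rP q : 0 < q < r -> [/\ 0 < q < r0, 0 < q < r1 & 0 < q < r2].
  by move=> /andP[q0]; rewrite !lt_min q0 => /and3P[-> -> ->].
have yP q : 0 < q < r -> `|y q - a| < e /\ root (P q) (y q).
  move=> /rP[_ _ /ex[z za rz]]; rewrite /y; case: xgetP => [? -> //|/(_ z) []].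
  by split => //; apply: lt_trans za _; lra.
have incP q : 0 < q < r -> increasing_near (P q) a e.
  move=> /rP[_ /inc incq _].
  by apply: increasing_near_le incq; rewrite subrr normr0 add0r.
have yU q z : 0 < q < r -> `|z - a| < e -> root (P q) z -> z = y q.
  by move=> qr za rz; have [ya ry] := yP _ qr;
    exact: increasing_near_root_inj (incP _ qr) za ya rz ry.
exists r, e, y; split => //.
- move=> q qr; have [ya ry] := yP _ qr; split => //.
  have [qr0 _ _] := rP _ qr.
  apply: (unique_root_cvg _ sP (sP q) (cont _ qr0)
    (e := e - `|y q - a|)) => //.
  + by rewrite subr_gt0.
  + by apply: increasing_near_le (incP _ qr); lra.
  + have : \forall s \near q, s \in `]0, r[.
      by apply: near_in_itvoo; rewrite in_itv.
    apply: filterS => s; rewrite in_itv /= => sr z zy; apply: yU => //.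
    by rewrite (le_lt_trans (ler_distD (y q) _ _))// -ltrBrDr.
- apply: (unique_root_cvg _ sP sQ cP e0 incQ rQ).
  by apply/near_right0P; exists r => // q qr z; exact: yU.
Qed.

(** * Power asymptotics at [0+] *)

(** The constant [C] may vanish: then [u] is only known to be smaller than
    [q^a], which is what neglected terms need. *)
Record asymp (R : realType) (u : R -> R) (a C : R) : Prop := Asymp {
  asymp_limit : u q * q `^ (- a) @[q --> (0 : R)^'+] --> C }.

Lemma near_pos (R : realType) : \forall q \near (0 : R)^'+, 0 < q.
Proof. exact: nbhs_right_gt. Qed.

Lemma powRDpos (R : realType) (q a b : R) :
  0 < q -> q `^ (a + b) = q `^ a * q `^ b.
Proof. by move=> q0; rewrite powRD// lt0r_neq0// implybT. Qed.

Lemma asymp_near (R : realType) (u v : R -> R) (a C : R) :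
  (\forall q \near (0 : R)^'+, u q = v q) -> asymp u a C -> asymp v a C.
Proof.
move=> e [c1]; split; apply: cvg_trans c1; apply: near_eq_cvg.
by apply: filterS e => s ->.
Qed.

Lemma asymp_pos (R : realType) (u v : R -> R) (a C : R) :
  (forall q, 0 < q -> u q = v q) -> asymp u a C -> asymp v a C.
Proof.
move=> e cu; apply: asymp_near cu; apply: filterS (near_pos R) => q; exact: e.
Qed.

Lemma asymp_eq (R : realType) (u : R -> R) (a b C D : R) :
  asymp u a C -> a = b -> C = D -> asymp u b D.
Proof. by move=> ? <- <-. Qed.

Lemma asympD (R : realType) (u v : R -> R) (a C D : R) :
  asymp u a C -> asymp v a D -> asymp (fun q => u q + v q) a (C + D).
Proof.
by move=> [cu] [cv]; split; under eq_cvg do rewrite mulrDl; exact: cvgD.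
Qed.

Lemma asympN (R : realType) (u : R -> R) (a C : R) :
  asymp u a C -> asymp (fun q => - u q) a (- C).
Proof.
by move=> [cu]; split; under eq_cvg do rewrite mulNr; exact: cvgN.
Qed.

Lemma asympB (R : realType) (u v : R -> R) (a C D : R) :
  asymp u a C -> asymp v a D -> asymp (fun q => u q - v q) a (C - D).
Proof. by move=> cu cv; apply: asympD => //; exact: asympN. Qed.

Lemma asympM (R : realType) (u v : R -> R) (a b C D : R) :
  asymp u a C -> asymp v b D -> asymp (fun q => u q * v q) (a + b) (C * D).
Proof.
move=> [cu] [cv]; split.
apply: cvg_trans (cvgM cu cv); apply: near_eq_cvg.
apply: filterS (near_pos R) => q q0 /=.
by rewrite opprD (powRDpos _ _ q0) mulrACA.
Qed.

Lemma asympV (R : realType) (u : R -> R) (a C : R) :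
  C != 0 -> asymp u a C -> asymp (fun q => (u q)^-1) (- a) C^-1.
Proof.
move=> C0 [cu]; split.
under eq_cvg do rewrite powRN -invfM.
exact: (cvgV C0 cu).
Qed.

Lemma asymp_cst {R : realType} (C : R) : asymp (fun=> C) 0 C.
Proof.
split; under eq_cvg do rewrite oppr0 powRr0 mulr1.
exact: cvg_cst.
Qed.

Lemma asympZ (R : realType) (u : R -> R) (a C k : R) :
  asymp u a C -> asymp (fun q => k * u q) a (k * C).
Proof.
by move=> cu; apply: (asymp_eq (asympM (asymp_cst k) cu)); rewrite ?add0r.
Qed.

Lemma asymp_powR {R : realType} (a : R) : asymp (fun q => q `^ a) a 1.
Proof.
split; apply: cvg_near_cst; apply: filterS (near_pos R) => q q0.
by rewrite -powRDpos// subrr powRr0.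
Qed.

Lemma asymp_exprn (R : realType) (u : R -> R) (a C : R) (n : nat) :
  asymp u a C -> asymp (fun q => u q ^+ n) (n%:R * a) (C ^+ n).
Proof.
move=> cu; elim: n => [|n IHn].
  by apply: (asymp_eq (asymp_cst 1)); rewrite ?mul0r.
rewrite exprS; under eq_fun do rewrite exprS.
apply: (asymp_eq (asympM cu IHn)) => //.
by rewrite -natr1; ring.
Qed.

Lemma asymp_id (R : realType) : asymp (fun q : R => q) 1 1.
Proof. by apply: asymp_pos (asymp_powR 1) => q q0; rewrite powRr1// ltW. Qed.

Lemma asymp_cvg (R : realType) (u : R -> R) (C : R) :
  asymp u 0 C -> u q @[q --> (0 : R)^'+] --> C.
Proof.
move=> [cu]; apply: cvg_trans cu; apply: near_eq_cvg.
by apply: nearW => q; rewrite oppr0 powRr0 mulr1.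
Qed.

Lemma cvg_asymp (R : realType) (u : R -> R) (C : R) :
  u q @[q --> (0 : R)^'+] --> C -> asymp u 0 C.
Proof.
move=> cu; split; apply: cvg_trans cu; apply: near_eq_cvg.
by apply: nearW => q; rewrite oppr0 powRr0 mulr1.
Qed.

Lemma asymp_lt (R : realType) (u : R -> R) (a b C : R) :
  b < a -> asymp u a C -> asymp u b 0.
Proof.
move=> ba [cu]; split.
have ab : 0 < a - b by lra.
have cv : u q * q `^ (- a) * q `^ (a - b) @[q --> (0 : R)^'+] --> C * 0.
  exact: cvgM cu (powR_cvg0 ab).
rewrite mulr0 in cv; apply: cvg_trans cv.
apply: near_eq_cvg; apply: filterS (near_pos R) => q q0 /=.
by rewrite -mulrA -powRDpos// addrA addNr add0r.
Qed.

Lemma asympD_lt (R : realType) (u v : R -> R) (a b C D : R) :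
  a < b -> asymp u a C -> asymp v b D -> asymp (fun q => u q + v q) a C.
Proof.
move=> ab cu cv; apply: (asymp_eq (asympD cu (asymp_lt ab cv))) => //.
by rewrite addr0.
Qed.

Lemma asymp_neq0 (R : realType) (u : R -> R) (a C : R) :
  C != 0 -> asymp u a C -> \forall q \near (0 : R)^'+, u q != 0.
Proof.
move=> C0 [cu].
have u0 : \forall q \near (0 : R)^'+, u q * q `^ (- a) != 0.
  exact: (cvgr_neq0 _ cu C0).
apply: filterS u0 => q.
by apply: contraNN => /eqP ->; rewrite mul0r.
Qed.

Lemma asymp_sim (R : realType) (u v : R -> R) (a C : R) :
  C != 0 -> asymp u a C -> asymp v a C -> sim u v.
Proof.
move=> C0 cu cv; apply: asymp_cvg.
apply: (asymp_eq (asympM cu (asympV C0 cv))); first exact: subrr.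
exact: divff.
Qed.

Lemma powR_continuous (R : realType) (a q : R) :
  0 < q -> s `^ a @[s --> q] --> q `^ a.
Proof.
move=> q0; have D := is_derive1_powR a q0.
have /derivable1_diffP/differentiable_continuous := @ex_derive _ _ _ _ _ _ _ D.
exact.
Qed.

(** * Polynomials with a convex Newton polygon *)

Lemma prod_seq_neq0 (R : idomainType) (d : nat -> R) (n : nat) :
  (forall i, d i != 0) -> \prod_(0 <= i < n) d i != 0.
Proof. by move=> d0; rewrite prodf_seq_neq0; apply/allP => i _; exact: d0. Qed.

Lemma size_prod_linear (R : idomainType) (N : nat) (a : nat -> R) :
  (size (\prod_(0 <= j < N) (1 + a j *: 'X : {poly R}))%R <= N.+1)%N.
Proof.
elim: N => [|N IHN]; first by rewrite big_nil size_poly1.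
rewrite big_nat_recr//=; apply: leq_trans (size_polyMleq _ _) _.
have s2 : (size (1 + a N *: 'X : {poly R})%R <= 2)%N.
  apply: leq_trans (size_polyD _ _) _; rewrite geq_max size_poly1.
  by apply: leq_trans (size_scale_leq _ _) _; rewrite size_polyX.
by move: IHN s2; set s := size _; set s' := size _; lia.
Qed.

Lemma coef_mul_linear (R : comNzRingType) (P : {poly R}) (a : R) (n : nat) :
  (P * (1 + a *: 'X))`_n = P`_n + a * (if n is m.+1 then P`_m else 0).
Proof.
by rewrite mulrDr mulr1 coefD -scalerAr coefZ coefMX; case: n.
Qed.

(** In the elementary symmetric function of degree [n] the product of the [n]
    largest [a j] dominates. *)
Lemma prod_linear_coef_asymp (R : realType) (N : nat) (a : nat -> R -> R)
    (eps d : nat -> R) :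
  (forall j, (j < N)%N -> asymp (a j) (eps j) (d j)) ->
  (forall i j, (i < j < N)%N -> eps i < eps j) ->
  forall n, (n <= N)%N ->
    asymp (fun q => (\prod_(0 <= j < N) (1 + a j q *: 'X : {poly R}))`_n)
      (\sum_(0 <= i < n) eps i) (\prod_(0 <= i < n) d i).
Proof.
elim: N => [|N IHN] ha heps n nN.
  move: nN; rewrite leqn0 => /eqP ->; rewrite !big_nil.
  by under eq_fun do rewrite big_nil coef1; exact: asymp_cst.
have {}IHN m : (m <= N)%N ->
    asymp (fun q => (\prod_(0 <= j < N) (1 + a j q *: 'X : {poly R}))`_m)
      (\sum_(0 <= i < m) eps i) (\prod_(0 <= i < m) d i).
  apply: IHN => [j jN|i j /andP[ij jN]]; first exact/ha/leqW.
  by apply: heps; rewrite ij leqW.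
under eq_fun do rewrite big_nat_recr//= coef_mul_linear.
case: n nN => [_|n nN].
  by under eq_fun do rewrite /= mulr0 addr0; exact: IHN.
have an := asympM (ha N (leqnn _)) (IHN n nN).
rewrite !big_nat_recr//=; move: nN; rewrite ltnS leq_eqVlt => /orP[/eqP nN|nN].
  subst n; under eq_fun do rewrite nth_default ?size_prod_linear// add0r.
  by apply: (asymp_eq an); [exact: addrC|exact: mulrC].
have := IHN n.+1 nN; rewrite !big_nat_recr//= => IHn.
apply: asympD_lt IHn an.
by rewrite addrC ltrD2r heps// nN ltnSn.
Qed.

(** A line of slope [eps j] supports the convex graph of the partial sums of
    [eps] exactly along its [j]-th edge. *)
Lemma newton_edge (R : realType) (N : nat) (eps : nat -> R) (j n : nat) :
  (forall i j, (i < j < N)%N -> eps i < eps j) -> (j < N)%N -> (n <= N)%N ->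
  n != j -> n != j.+1 ->
  \sum_(0 <= i < j) eps i - j%:R * eps j
    < \sum_(0 <= i < n) eps i - n%:R * eps j.
Proof.
move=> heps jN; pose B n := \sum_(0 <= i < n) eps i - n%:R * eps j.
rewrite -/(B j) -/(B n).
have BS m : B m.+1 = B m + (eps m - eps j).
  by rewrite /B big_nat_recr//= -natr1; ring.
have Bj : B j.+1 = B j by rewrite BS subrr addr0.
have up m : (j.+1 + m < N)%N -> B j < B (j.+1 + m.+1)%N.
  elim: m => [|m IHm] mN.
    rewrite addn1 BS Bj ltrDl subr_gt0; apply: heps; lia.
  rewrite addnS BS (lt_trans (IHm _))//; first lia.
  by rewrite ltrDl subr_gt0; apply: heps; lia.
have down m : (m < j)%N -> B j < B (j - m.+1)%N.
  elim: m => [|m IHm] mj.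
    have e : j = (j - 1).+1 by lia.
    rewrite [X in B X < _]e BS gtrDl subr_lt0; apply: heps; lia.
  apply: lt_trans (IHm (ltnW mj)) _.
  have -> : (j - m.+1 = (j - m.+2).+1)%N by lia.
  by rewrite BS gtrDl subr_lt0; apply: heps; lia.
move=> nN nj nj1; case: (ltnP n j) => h.
  have -> : n = (j - (j - n.+1).+1)%N by lia.
  by apply: down; lia.
have -> : n = (j.+1 + (n - j.+2).+1)%N by lia.
by apply: up; lia.
Qed.

(** When the Newton polygon of [f q] is strictly convex, its [j]-th edge
    carries a single root, close to minus the inverse of the [j]-th ratio of
    coefficients: in the scale of that edge only the two end monomials survive
    in the limit, which leaves [X^j (1 - X)] and its simple root 1. *)
Lemma newton_polygon_branch (R : realType) (N : nat) (f : R -> {poly R})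
    (eps d : nat -> R) (r0 : R) (j : nat) :
  0 < r0 -> (forall q, (size (f q) <= N.+1)%N) ->
  (forall q, 0 < q < r0 -> coef_cvg (nbhs q) f (f q)) ->
  (forall i, d i != 0) ->
  (forall n, (n <= N)%N -> asymp (fun q => (f q)`_n)
     (\sum_(0 <= i < n) eps i) (\prod_(0 <= i < n) d i)) ->
  (forall i j, (i < j < N)%N -> eps i < eps j) ->
  (j < N)%N ->
  exists (r : R) (x : R -> R),
    [/\ 0 < r, forall q, 0 < q < r -> root (f q) (x q),
        {within `]0, r[, continuous x}
      & asymp x (- eps j) (- (d j)^-1)].
Proof.
move=> r00 szf cont d0 hf heps jN.
have dP n := prod_seq_neq0 n d0.
pose A n := \sum_(0 <= i < n) eps i; pose D n := \prod_(0 <= i < n) d i.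
pose s q : R := - (d j)^-1 * q `^ (- eps j).
(* [K] makes the limit of the coefficient of [X^j] equal to 1. *)
pose K : R := (D j * (- (d j)^-1) ^+ j)^-1.
pose kap q : R := K * q `^ (- (A j - j%:R * eps j)).
pose P q := kap q *: (f q \Po (s q *: 'X)).
pose Q : {poly R} := 'X^j - 'X^(j.+1).
have dj0 : - (d j)^-1 != 0 by rewrite oppr_eq0 invr_eq0.
have K0 : D j * (- (d j)^-1) ^+ j != 0.
  by apply: mulf_neq0; [exact: dP|exact: expf_neq0].
have coefP q n : (P q)`_n = kap q * (s q ^+ n * (f q)`_n).
  by rewrite coefZ coef_dilation.
have szP q : (size (P q) <= N.+1)%N.
  apply/leq_sizeP => n nN; rewrite coefP (nth_default 0 (leq_trans (szf q) nN)).
  by rewrite !mulr0.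
have szQ : (size Q <= N.+1)%N.
  apply: leq_trans (size_polyD _ _) _.
  by rewrite size_polyN !size_polyXn geq_max !ltnS jN ltnW.
have contP q : 0 < q < r0 -> coef_cvg (nbhs q) P (P q).
  move=> qr n; rewrite coefP; under eq_cvg do rewrite coefP.
  have /andP[q0 _] := qr.
  apply: cvgM; first by apply: cvgM; [exact: cvg_cst|exact: powR_continuous].
  apply: cvgM; last exact: cont.
  apply: cvg_exprn; apply: cvgM; [exact: cvg_cst|exact: powR_continuous].
have limP : coef_cvg (0 : R)^'+ P Q.
  move=> n; under eq_cvg do rewrite coefP.
  rewrite coefB !coefXn.
  case: (leqP n N) => nN; last first.
    have [-> ->] : (n == j = false) /\ (n == j.+1 = false) by split; lia.
    rewrite subrr; apply: cvg_near_cst; apply: nearW => q.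
    by rewrite (nth_default 0 (leq_trans (szf q) nN)) !mulr0.
  have as0 : asymp (fun q => kap q * (s q ^+ n * (f q)`_n))
      (- (A j - j%:R * eps j) + (n%:R * (- eps j) + A n))
      (K * 1 * ((- (d j)^-1 * 1) ^+ n * D n)).
    apply: asympM; first by apply: asympZ; exact: asymp_powR.
    apply: asympM; last exact: hf.
    by apply: asymp_exprn; apply: asympZ; exact: asymp_powR.
  apply: asymp_cvg; have [nj|nj] := eqVneq n j.
    subst n; apply: (asymp_eq as0); first by ring.
    by rewrite !mulr1 [_ * D j]mulrC mulVf// ltn_eqF ?subr0.
  have [nj1|nj1] := eqVneq n j.+1.
    subst n; apply: (asymp_eq as0).
      by rewrite /A big_nat_recr//= -natr1; ring.
    rewrite sub0r !mulr1 /D big_nat_recr//= -/(D j) exprSr.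
    have -> : (- (d j)^-1) ^+ j * - (d j)^-1 * (D j * d j)
      = (D j * (- (d j)^-1) ^+ j) * - ((d j)^-1 * d j) by ring.
    by rewrite mulVf ?d0// mulrN1 mulrN mulVf.
  rewrite subr0; apply: asymp_lt as0.
  have := newton_edge heps jN nN nj nj1; rewrite -/(A j) -/(A n); lra.
have rQ : root Q 1 by rewrite /root !hornerE !expr1n subrr.
have dQ : Q^`().[1] != 0.
  rewrite derivB !derivXn hornerD hornerN !hornerMn !hornerXn !expr1n.
  by rewrite /= mulrS opprD addrCA subrr addr0 oppr_eq0 oner_neq0.
have [r [e [y [r_gt0 _ yP _ ylim]]]] :=
  simple_root_branch r00 szP szQ contP limP rQ dQ.
exists r, (fun q => s q * y q); split => //.
- move=> q qr; have [ry _] := yP q qr; have /andP[q0 _] := qr.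
  move: ry; rewrite /P rootZ; last first.
    by apply: mulf_neq0; [rewrite invr_eq0|rewrite lt0r_neq0// powR_gt0].
  by rewrite /root horner_comp !hornerE mulrC.
- apply: continuous_subspace_itv => q; rewrite in_itv/= => qr.
  have [_ cy] := yP q qr; have /andP[q0 _] := qr.
  apply: cvgM => //; apply: cvgM; [exact: cvg_cst|exact: powR_continuous].
- apply: (asymp_eq (asympM (asympZ _ (asymp_powR _)) (cvg_asymp ylim))).
    by rewrite addr0.
  by rewrite !mulr1.
Qed.

(** * The scaled recurrence *)

Record admissible (R : realType) (p : qHeun_params R) (N k : nat) : Prop := {
  adm_N : N%:R = - lambda1 p - alpha1 p;
  adm_beta : beta p < 1;
  adm_alpha : alpha2 p - alpha1 p < 1;
  adm_t1 : 0 < t1 p;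
  adm_t2 : 0 < t2 p;
  adm_h : h1 p < h2 p;
  adm_l : l1 p < l2 p;
  adm_A : 0 < 1 + h2 p - l2 p - beta p;
  adm_B : 0 < 2 + 2 * h2 p - l1 p - l2 p - beta p;
  adm_k : (1 <= k <= N.+1)%N }.

Section qHeun.
Variables (R : realType) (p : qHeun_params R) (N k : nat).
Hypothesis adm : admissible p N k.

Lemma t1_neq0 : t1 p != 0. Proof. exact: lt0r_neq0 (adm_t1 adm). Qed.
Lemma t2_neq0 : t2 p != 0. Proof. exact: lt0r_neq0 (adm_t2 adm). Qed.

Lemma asymp_1B_pos (b : R) : 0 < b -> asymp (fun q => 1 - q `^ b) 0 1.
Proof.
by move=> b0; apply: asympD_lt b0 (asymp_cst 1) (asympN (asymp_powR b)).
Qed.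

Lemma asymp_1B_neg (b : R) : b < 0 -> asymp (fun q => 1 - q `^ b) b (-1).
Proof.
move=> b0; have a1 := asympB (asymp_lt b0 (asymp_cst 1)) (asymp_powR b).
by apply: (asymp_eq a1) => //; rewrite sub0r.
Qed.

Lemma one_sub_powR_neq0 (q b : R) : 0 < q < 1 -> b != 0 -> 1 - q `^ b != 0.
Proof.
move=> /andP[q0 q1] b0; rewrite subr_eq0 eq_sym powR_eq1 (negPf b0) orbF.
by rewrite lt_eqF//= -leNgt ltW.
Qed.

Lemma lead_asymp (n : nat) : (0 < n)%N ->
  asymp (fun q => lead_rec p q n) (h1 p + h2 p) (t1 p * t2 p).
Proof.
move=> n0; have n1 : (1 : R) <= n%:R by rewrite ler1n.
have ab : 0 < n%:R - beta p by have := adm_beta adm; lra.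
have a1 : asymp (fun q : R => 1 - q ^+ n) 0 1.
  apply: (@asymp_pos _ (fun q => 1 - q `^ n%:R)) => [q q0|].
    by rewrite powR_mulrn// ltW.
  by apply: asymp_1B_pos; rewrite ltr0n.
have a0 := asympZ (t1 p * t2 p) (asymp_powR (h1 p + h2 p)).
by apply: (asymp_eq (asympM (asympM a0 a1) (asymp_1B_pos ab))); ring.
Qed.

Lemma lead_neq0 (q : R) (n : nat) :
  0 < q < 1 -> (0 < n)%N -> lead_rec p q n != 0.
Proof.
move=> /andP[q0 q1] n0; have n1 : (1 : R) <= n%:R by rewrite ler1n.
have ab : 0 < n%:R - beta p by have := adm_beta adm; lra.
rewrite /lead_rec -(powR_mulrn _ (ltW q0)) !mulf_eq0 !negb_or t1_neq0 t2_neq0.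
rewrite !one_sub_powR_neq0 ?q0 ?(lt0r_neq0 ab) ?pnatr_eq0 -?lt0n//.
by rewrite lt0r_neq0// powR_gt0.
Qed.

(** The power [q^(n - 2 - N)] has a negative exponent up to [n = N + 1], and
    [alpha2 - alpha1 < 1] gives the same for the other factor: both factors of
    [low_rec] are dominated by their powers of [q]. *)
Lemma low_exponents_lt0 (n : nat) : (n <= N.+1)%N ->
  n%:R - 2 + lambda1 p + alpha1 p < 0 /\ n%:R - 2 + lambda1 p + alpha2 p < 0.
Proof.
move=> nN; have nN' : (n%:R : R) <= N%:R + 1 by rewrite natr1 ler_nat.
by have := adm_N adm; have := adm_alpha adm; split; lra.
Qed.

Lemma low_asymp (n : nat) : (n <= N.+1)%N ->
  asymp (fun q => low_rec p q n)
    (2 * n%:R - 1 + h1 p + h2 p - l1 p - l2 p - beta p) 1.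
Proof.
move=> /low_exponents_lt0[e1 e2].
have a1 := asympM (asympM (asymp_id R) (asymp_1B_neg e1)) (asymp_1B_neg e2).
apply: (asymp_eq a1).
  by rewrite /lambda1; lra.
by ring.
Qed.

Lemma low_neq0 (q : R) (n : nat) :
  0 < q < 1 -> (n <= N.+1)%N -> low_rec p q n != 0.
Proof.
move=> q01 /low_exponents_lt0[e1 e2].
have /andP[q0 _] := q01.
rewrite /low_rec !mulf_eq0 !negb_or (lt0r_neq0 q0).
by rewrite !one_sub_powR_neq0// ltr0_neq0.
Qed.

Definition mid_cst (q : R) (n : nat) : R :=
  q `^ (1 / 2) * (q `^ h1 p * t1 p + q `^ h2 p * t2 p)
     + (q `^ l1 p * t1 p + q `^ l2 p * t2 p)
       * q `^ (2 * (n%:R - 1 + lambda1 p) + alpha1 p + alpha2 p - 1 / 2).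

Lemma mid_recE (q : R) (n : nat) :
  mid_rec p q n = q `^ (n%:R - 1 + lambda1 p) *: 'X + (mid_cst q n)%:P.
Proof. by []. Qed.

(** The condition [1 + h2 - l2 - beta > 0] makes the terms in [l1] and [l2]
    negligible already at [n = 1]. *)
Lemma mid_cst_asymp (n : nat) : (0 < n)%N ->
  asymp (fun q => mid_cst q n) (1 / 2 + h1 p) (t1 p).
Proof.
move=> n0; have n1 : (1 : R) <= n%:R by rewrite ler1n.
have pw (t b : R) : asymp (fun q => q `^ b * t) b t.
  apply: (asymp_eq (asympM (asymp_powR b) (asymp_cst t))); first exact: addr0.
  exact: mul1r.
have a1 := asympM (asymp_powR (1 / 2))
  (asympD_lt (adm_h adm) (pw (t1 p) _) (pw (t2 p) (h2 p))).
have a2 := asympM (asympD_lt (adm_l adm) (pw (t1 p) _) (pw (t2 p) (l2 p)))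
  (asymp_powR (2 * (n%:R - 1 + lambda1 p) + alpha1 p + alpha2 p - 1 / 2)).
rewrite -[X in asymp _ _ X](mul1r (t1 p)); apply: asympD_lt a1 a2.
by rewrite /lambda1; have := adm_A adm; have := adm_h adm; lra.
Qed.

(** The size expected of the [k]-th root, used as the unit for [E]. *)
Definition root_scale (q : R) : R :=
  - q `^ (3 / 2 - k%:R + h1 p - lambda1 p) * t1 p.

(** In the unit [root_scale] the two terms of [mid_rec] have sizes
    [q^(m - k)] and 1 relatively to [q^(h1 + 1/2) t1]; the truncated difference
    [k - m] normalizes the larger one. *)
Definition step_exp (m : nat) : R := h2 p - 1 / 2 + (k - m)%:R.

Definition step_scale (q : R) (m : nat) : R := t2 p * q `^ step_exp m.

Definition coef_scale (q : R) (n : nat) : R :=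
  \prod_(0 <= i < n) step_scale q i.+1.

(** The polynomials [c_n] after blowing up: the unknown [E] is measured in
    units of the expected size of the [k]-th root and [c_n] is normalized so
    that its limit exists and is not zero. *)
Definition scaled_c (q : R) (n : nat) : {poly R} :=
  coef_scale q n *: (c p q n \Po (root_scale q *: 'X)).

(** The term of [mid_rec] in [E] dominates below the index [k], the constant
    term above it, and both survive at [k]. *)
Definition limit_factor (m : nat) : {poly R} :=
  (if (m <= k)%N then -1 else 0) *: 'X + (if (k <= m)%N then 1 else 0)%:P.

Definition limit_c (n : nat) : {poly R} := \prod_(0 <= i < n) limit_factor i.+1.

Lemma root_scale_asymp :
  asymp root_scale (3 / 2 - k%:R + h1 p - lambda1 p) (- t1 p).
Proof.
apply: (asymp_eq (asympM (asympN (asymp_powR _)) (asymp_cst (t1 p)))).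
  by rewrite addr0.
by rewrite mulN1r.
Qed.

Lemma step_scale_asymp (m : nat) :
  asymp (fun q => step_scale q m) (step_exp m) (t2 p).
Proof.
by apply: (asymp_eq (asympZ (t2 p) (asymp_powR _))) => //; rewrite mulr1.
Qed.

Lemma root_scale_neq0 (q : R) : 0 < q -> root_scale q != 0.
Proof.
by move=> q0; rewrite mulf_neq0 ?t1_neq0// oppr_eq0 lt0r_neq0// powR_gt0.
Qed.

Lemma step_scale_neq0 (q : R) (m : nat) : 0 < q -> step_scale q m != 0.
Proof. by move=> q0; rewrite mulf_neq0 ?t2_neq0// lt0r_neq0// powR_gt0. Qed.

Lemma coef_scale_neq0 (q : R) (n : nat) : 0 < q -> coef_scale q n != 0.
Proof. by move=> q0; apply: prod_seq_neq0 => i; exact: step_scale_neq0. Qed.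

Lemma mid_scaled_cvg (m : nat) : (0 < m)%N ->
  coef_cvg (0 : R)^'+
    (fun q => (step_scale q m / lead_rec p q m) *:
              (mid_rec p q m \Po (root_scale q *: 'X)))
    (limit_factor m).
Proof.
move=> m0.
have t12 : t1 p * t2 p != 0 by rewrite mulf_neq0 ?t1_neq0 ?t2_neq0.
have aV := asympV t12 (lead_asymp m0).
have a0 := asympM (step_scale_asymp m) aV.
have aX := asympM a0
  (asympM (asymp_powR (m%:R - 1 + lambda1 p)) root_scale_asymp).
have aC := asympM a0 (mid_cst_asymp m0).
have -> : (fun q => (step_scale q m / lead_rec p q m) *:
      (mid_rec p q m \Po (root_scale q *: 'X))) =
    (fun q => (step_scale q m / lead_rec p q m *
       (q `^ (m%:R - 1 + lambda1 p) * root_scale q)) *: 'X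
       + (step_scale q m / lead_rec p q m * mid_cst q m)%:P).
  apply/funext => q; rewrite mid_recE.
  rewrite comp_polyD comp_polyZ comp_polyX comp_polyC.
  by rewrite -!mul_polyC !polyCM; ring.
apply: coef_cvgD.
  apply: coef_cvgZ; last exact: coef_cvg_cst.
  apply: asymp_cvg; case: ifPn => mk.
    apply: (asymp_eq aX); last by field; rewrite t1_neq0 t2_neq0.
    by rewrite /step_exp natrB//; lra.
  apply: asymp_lt aX; rewrite /step_exp (_ : (k - m = 0)%N); last lia.
  have : (k%:R : R) + 1 <= m%:R by rewrite natr1 ler_nat; lia.
  by rewrite mulr0n; lra.
apply: coef_cvg_polyC; apply: asymp_cvg; case: ifPn => mk.
  apply: (asymp_eq aC); last by field; rewrite t1_neq0 t2_neq0.
  by rewrite /step_exp (_ : (k - m = 0)%N); [rewrite mulr0n; lra|lia].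
apply: asymp_lt aC; rewrite /step_exp natrB; last lia.
have : (m%:R : R) + 1 <= k%:R by rewrite natr1 ler_nat; lia.
by lra.
Qed.

(** The three-term recurrence becomes a two-term one in the limit. *)
Lemma low_scaled_cvg (m : nat) : (1 < m <= N.+1)%N ->
  step_scale q m * step_scale q m.-1 * low_rec p q m / lead_rec p q m
    @[q --> (0 : R)^'+] --> 0.
Proof.
move=> /andP[m1 mN]; have m0 := ltnW m1.
have t12 : t1 p * t2 p != 0 by rewrite mulf_neq0 ?t1_neq0 ?t2_neq0.
have a1 := asympM (step_scale_asymp m) (step_scale_asymp m.-1).
have a2 := asympM (asympM a1 (low_asymp mN)) (asympV t12 (lead_asymp m0)).
apply: asymp_cvg; apply: asymp_lt a2; rewrite /step_exp.
have : (0 : R) <= (k - m)%:R by [].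
have : (0 : R) <= (k - m.-1)%:R by [].
have : (2 : R) <= m%:R by rewrite ler_nat.
by have := adm_B adm; lra.
Qed.

Lemma scaled_c1 (q : R) : scaled_c q 1 =
  ((step_scale q 1 / lead_rec p q 1) *:
     (mid_rec p q 1 \Po (root_scale q *: 'X))) * scaled_c q 0.
Proof.
rewrite /scaled_c /coef_scale big_nat1 big_nil.
rewrite /= scaler0 subr0 mul1r comp_polyZ comp_polyC scalerA scale1r.
by rewrite mulr1.
Qed.

Lemma scaled_cSS (q : R) (n : nat) : scaled_c q n.+2 =
  ((step_scale q n.+2 / lead_rec p q n.+2) *:
     (mid_rec p q n.+2 \Po (root_scale q *: 'X))) * scaled_c q n.+1
  - (step_scale q n.+2 * step_scale q n.+1 * low_rec p q n.+2
     / lead_rec p q n.+2) *: scaled_c q n.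
Proof.
rewrite /scaled_c.
have -> : c p q n.+2 = (lead_rec p q n.+2)^-1 *:
  (c p q n.+1 * mid_rec p q n.+2 - low_rec p q n.+2 *: c p q n) by [].
have sS m : coef_scale q m.+1 = coef_scale q m * step_scale q m.+1.
  by rewrite /coef_scale big_nat_recr.
rewrite !sS; move: (c p q n.+1) (c p q n) => c1 c0.
rewrite comp_polyZ comp_polyB comp_polyM comp_polyZ -!mul_polyC !polyCM.
by ring.
Qed.

Lemma scaled_c_cvg (n : nat) : (n <= N.+1)%N ->
  coef_cvg (0 : R)^'+ (scaled_c ^~ n) (limit_c n).
Proof.
elim/ltn_ind: n => -[|[|n]] IHn nN.
- have -> : scaled_c ^~ 0%N = fun=> limit_c 0.
    apply/funext => q; rewrite /scaled_c /coef_scale /limit_c !big_nil.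
    by rewrite scale1r comp_polyC.
  exact: coef_cvg_cst.
- have -> : scaled_c ^~ 1%N = fun q => ((step_scale q 1 / lead_rec p q 1) *:
     (mid_rec p q 1 \Po (root_scale q *: 'X))) * scaled_c q 0.
    by apply/funext => q; exact: scaled_c1.
  have -> : limit_c 1 = limit_factor 1 * limit_c 0.
    by rewrite /limit_c big_nat1 big_nil mulr1.
  by apply: coef_cvgM; [exact: mid_scaled_cvg|exact: IHn].
- have -> := funext (scaled_cSS ^~ n : scaled_c ^~ n.+2 =1 fun q => _).
  have -> : limit_c n.+2 = limit_factor n.+2 * limit_c n.+1 - 0 *: limit_c n.
    by rewrite scale0r subr0 /limit_c [in LHS]big_nat_recr//= mulrC.
  apply: coef_cvgB.
    by apply: coef_cvgM; [exact: mid_scaled_cvg|apply: IHn => //; exact: ltnW].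
  apply: coef_cvgZ; first exact: (low_scaled_cvg (m := n.+2)).
  by apply: IHn => //; lia.
Qed.

Lemma limit_factorE (m : nat) : limit_factor m =
  if (m < k)%N then - 'X else if m == k then 1 - 'X else 1.
Proof.
rewrite /limit_factor; case: ltngtP => _.
- by rewrite scaleN1r addr0.
- by rewrite scale0r add0r.
- by rewrite scaleN1r addrC.
Qed.

Lemma limit_c_lt (n : nat) : (n < k)%N -> limit_c n = (- 'X) ^+ n.
Proof.
move=> nk; rewrite /limit_c big_nat.
under eq_bigr => i /andP[_ ni].
  rewrite limit_factorE (leq_trans _ nk); last by rewrite ltnS.
  over.
by rewrite -big_nat prodr_const_nat subn0.
Qed.

(** The simple root 1 of this limit is the unknown [E] at its expected size. *)
Lemma limit_c_ge (n : nat) :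
  (k <= n)%N -> limit_c n = (- 'X) ^+ k.-1 * (1 - 'X).
Proof.
move=> kn; have k0 : (0 < k)%N by case/andP: (adm_k adm).
have kS : k = k.-1.+1 by lia.
rewrite /limit_c (big_cat_nat (n := k))//= [X in _ * X]big_nat.
rewrite [X in _ * X]big1 ?mulr1; last first.
  move=> i /andP[ki _]; rewrite limit_factorE ltnNge (leq_trans ki)//=.
  by rewrite gtn_eqF// ltnS.
rewrite [in LHS]kS big_nat_recr//= -kS -/(limit_c _) limit_c_lt; last lia.
by rewrite limit_factorE ltnn eqxx.
Qed.

Lemma size_affine (a b : R) : (size (a *: 'X + b%:P)%R <= 2)%N.
Proof.
apply: leq_trans (size_polyD _ _) _; rewrite geq_max.
rewrite (leq_trans (size_scale_leq _ _)) ?size_polyX//=.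
exact: leq_trans (size_polyC_leq1 _) _.
Qed.

Lemma size_c (q : R) (n : nat) : (size (c p q n) <= n.+1)%N.
Proof.
elim/ltn_ind: n => -[|n] IHn; first by rewrite size_poly1.
rewrite [c _ _ _]/=.
apply: leq_trans (size_scale_leq _ _) _; apply: leq_trans (size_polyD _ _) _.
rewrite geq_max size_polyN; apply/andP; split.
  apply: leq_trans (size_polyMleq _ _) _.
  have s2 : (size (mid_rec p q n.+1) <= 2)%N by exact: size_affine.
  have := IHn n (ltnSn _); move: s2.
  by set s := size _; set s' := size _; lia.
apply: leq_trans (size_scale_leq _ _) _.
case: n IHn => [|n] IHn; first by rewrite size_poly0.
by apply: leq_trans (IHn n _) _ => //; lia.
Qed.

Lemma size_scaled_c (q : R) (n : nat) : (size (scaled_c q n) <= n.+1)%N.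
Proof.
apply/leq_sizeP => i ni; rewrite coefZ coef_dilation.
by rewrite (nth_default 0 (leq_trans (size_c q n) ni)) !mulr0.
Qed.

Lemma size_limit_c (n : nat) : (size (limit_c n) <= n.+1)%N.
Proof.
elim: n => [|n IHn]; first by rewrite /limit_c big_nil size_poly1.
rewrite /limit_c big_nat_recr//=; apply: leq_trans (size_polyMleq _ _) _.
have := size_affine (if (n.+1 <= k)%N then -1 else 0)
  (if (k <= n.+1)%N then 1 else 0).
move: IHn; rewrite /limit_c /limit_factor.
by set s := size _; set s' := size _; lia.
Qed.

Section at_root.
Variable E : R -> R.
Hypotheses (hroot : \forall q \near (0 : R)^'+, root (c p q N.+1) (E q))
  (hE : sim E root_scale).

Definition root_coef (n : nat) (q : R) : R := (c p q n).[E q].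

Lemma scaled_c_root_scale (q : R) (n : nat) (y : R) :
  (scaled_c q n).[y] = coef_scale q n * (c p q n).[root_scale q * y].
Proof. by rewrite hornerZ horner_comp !hornerE. Qed.

Lemma root_coef_scaled (q : R) (n : nat) : 0 < q ->
  root_coef n q = (scaled_c q n).[E q / root_scale q] / coef_scale q n.
Proof.
move=> q0; rewrite scaled_c_root_scale.
rewrite [coef_scale _ _ * _]mulrC mulfK ?coef_scale_neq0//.
by rewrite mulrC divfK ?root_scale_neq0.
Qed.

Lemma c_coef_cvg (q : R) (n : nat) : 0 < q < 1 ->
  coef_cvg (nbhs q) (fun s => c p s n) (c p q n).
Proof.
move=> q01; have /andP[q0 q1] := q01.
have pc (a : R) : s `^ a @[s --> q] --> q `^ a by exact: powR_continuous.
have cst (a : R) : a @[s --> q] --> a by exact: cvg_cst.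
have idc : s @[s --> q] --> q by exact: cvg_id.
have leadc m : (0 < m)%N ->
    (lead_rec p s m)^-1 @[s --> q] --> (lead_rec p q m)^-1.
  move=> m0; apply: cvgV; first exact: lead_neq0.
  apply: cvgM; last by apply: cvgB => //; exact: pc.
  apply: cvgM; last by apply: cvgB => //; exact: cvg_exprn.
  by apply: cvgM => //; exact: pc.
have lowc m : low_rec p s m @[s --> q] --> low_rec p q m.
  apply: cvgM; last by apply: cvgB => //; exact: pc.
  by apply: cvgM => //; apply: cvgB => //; exact: pc.
have midc m : coef_cvg (nbhs q) (fun s => mid_rec p s m) (mid_rec p q m).
  apply: coef_cvgD.
    by apply: coef_cvgZ; [exact: pc|exact: coef_cvg_cst].
  apply: coef_cvg_polyC; apply: cvgD; apply: cvgM.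
  - exact: pc.
  - by apply: cvgD; apply: cvgM => //; exact: pc.
  - by apply: cvgD; apply: cvgM => //; exact: pc.
  - exact: pc.
elim/ltn_ind: n => -[|[|n]] IHn; first exact: coef_cvg_cst.
- rewrite /=; apply: coef_cvgZ; first exact: leadc.
  apply: coef_cvgB.
    by apply: coef_cvgM => //; exact: coef_cvg_cst.
  by apply: coef_cvgZ => //; exact: coef_cvg_cst.
- apply: coef_cvgZ; first exact: leadc.
  apply: coef_cvgB.
    by apply: coef_cvgM => //; exact: (IHn n.+1 (ltnSn _)).
  by apply: coef_cvgZ => //; exact: (IHn n (ltnW (ltnSn _))).
Qed.

Lemma scaled_c_coef_cvg (q : R) (n : nat) : 0 < q < 1 ->
  coef_cvg (nbhs q) (scaled_c ^~ n) (scaled_c q n).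
Proof.
move=> q01 i; have /andP[q0 _] := q01.
have pc (a : R) : s `^ a @[s --> q] --> q `^ a by exact: powR_continuous.
have cst (a : R) : a @[s --> q] --> a by exact: cvg_cst.
rewrite coefZ coef_dilation; under eq_cvg do rewrite coefZ coef_dilation.
apply: cvgM; last first.
  apply: cvgM; last exact: c_coef_cvg.
  apply: cvg_exprn; apply: cvgM => //; apply: cvgN; exact: pc.
rewrite /coef_scale; elim: n => [|n IHn].
  by rewrite big_nil; under eq_cvg do rewrite big_nil; exact: cst.
rewrite big_nat_recr//=; under eq_cvg do rewrite big_nat_recr//=.
by apply: cvgM => //; apply: cvgM => //; exact: pc.
Qed.

(** The prescribed size of [E q] singles out a simple root of the limit of
    the scaled [c_(N+1)]; hence [E] is necessarily continuous near 0. *)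
Lemma root_continuous :
  exists2 r, 0 < r <= 1 &
    forall q, 0 < q < r -> root (c p q N.+1) (E q) /\ {for q, continuous E}.
Proof.
have k0 : (0 < k)%N by case/andP: (adm_k adm).
have kN : (k <= N.+1)%N by case/andP: (adm_k adm).
have rL : root (limit_c N.+1) 1.
  by rewrite limit_c_ge// rootM; apply/orP; right; rewrite /root !hornerE subrr.
have dL : (limit_c N.+1)^`().[1] != 0.
  rewrite limit_c_ge// derivM derivB derivX derivC !hornerE subrr mulr0 add0r.
  by rewrite mulf_neq0 ?expf_neq0 ?oppr_eq0 ?oner_neq0.
have [r [e [y [r0 e0 yP yU _]]]] := simple_root_branch (@ltr01 R)
  (fun q => size_scaled_c q N.+1) (size_limit_c N.+1)
  (fun q => @scaled_c_coef_cvg q N.+1) (scaled_c_cvg (leqnn _)) rL dL.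
have /near_right0P[r1 r10 near1] :
    \forall q \near (0 : R)^'+, `|1 - E q / root_scale q| < e.
  by move: hE; rewrite /sim => /cvgrPdist_lt; apply.
have /near_right0P[r2 r20 rootE] := hroot.
pose r' := Num.min 1 (Num.min r (Num.min r1 r2)).
have rP q : 0 < q < r' -> [/\ 0 < q < r, 0 < q < r1 & 0 < q < r2].
  by move=> /andP[q0]; rewrite !lt_min q0 => /and4P[_ -> -> ->].
have Ey q : 0 < q < r' -> E q = root_scale q * y q.
  move=> qr; have [q1 q2 q3] := rP _ qr; have /andP[q0 _] := qr.
  rewrite -(yU q (E q / root_scale q))//.
  - by rewrite mulrC divfK ?root_scale_neq0.
  - by rewrite distrC; exact: near1.
  - rewrite /root scaled_c_root_scale mulrC mulf_eq0.
    rewrite [root_scale _ * _]mulrC divfK ?root_scale_neq0//.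
    by have := rootE _ q3; rewrite /root => ->.
exists r'; first by rewrite !lt_min ltr01 r0 r10 r20 ge_min lexx.
move=> q qr; have [q1 q2 q3] := rP _ qr; have /andP[q0 _] := qr.
split; first exact: rootE.
have [_ cy] := yP _ q1.
have nearE : \forall s \near q, root_scale s * y s = E s.
  have : \forall s \near q, s \in `]0, r'[.
    by apply: near_in_itvoo; rewrite in_itv.
  by apply: filterS => s; rewrite in_itv/= => /Ey.
have cE : root_scale s * y s @[s --> q] --> E q.
  rewrite Ey//; apply: cvgM => //; apply: cvgM; last exact: cvg_cst.
  by apply: cvgN; exact: powR_continuous.
exact: cvg_trans (near_eq_cvg nearE) cE.
Qed.

Lemma root_coef_continuous :
  exists2 r : R, 0 < r & forall q : R, 0 < q < r ->
    forall n, root_coef n s @[s --> q] --> root_coef n q.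
Proof.
have [r /andP[r0 r1] rP] := root_continuous.
exists r => // q qr n; have [_ cE] := rP q qr; have /andP[q0 qr'] := qr.
have q01 : 0 < q < 1 by rewrite q0 (lt_le_trans qr').
exact: (coef_cvg_horner _ (fun s => size_c s n) (size_c q n) (c_coef_cvg q01)).
Qed.

(** Indices start from 0: [j] refers to the ratio [c_(j+1) / c_j]. *)
Definition ratio_exp (j : nat) : R :=
  if (j.+1 < k)%N then j.+1%:R - k%:R + 1 / 2 - h2 p
  else 2 * j.+1%:R + 1 / 2 + h2 p - l1 p - l2 p - beta p.

Definition ratio_cst (j : nat) : R :=
  if (j.+1 < k)%N then - (t2 p)^-1 else (t1 p)^-1.

Lemma ratio_cst_neq0 (j : nat) : ratio_cst j != 0.
Proof.
rewrite /ratio_cst.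
by case: ifP; rewrite ?oppr_eq0 invr_eq0 ?t1_neq0 ?t2_neq0.
Qed.

(** Convexity of the Newton polygon; at the vertex [k] it is the condition
    [2 + 2 h2 - l1 - l2 - beta > 0]. *)
Lemma ratio_exp_lt (i j : nat) : (i < j)%N -> ratio_exp i < ratio_exp j.
Proof.
move=> ij; rewrite /ratio_exp.
have ij' : (i.+1%:R : R) + 1 <= j.+1%:R by rewrite natr1 ler_nat.
have i1 : (1 : R) <= i.+1%:R by rewrite ler1n.
case: (ltnP i.+1 k) => ik; case: (ltnP j.+1 k) => jk.
- by lra.
- have : (i.+1%:R : R) + 1 <= k%:R by rewrite natr1 ler_nat.
  by have := adm_B adm; lra.
- by lia.
- by lra.
Qed.

(** Below the index [k] the limit polynomials are monomials, and so do not
    vanish at 1. *)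
Lemma ratio_asymp_lt (n : nat) : (n.+1 < k)%N ->
  asymp (fun q => root_coef n.+1 q / root_coef n q) (ratio_exp n) (ratio_cst n).
Proof.
move=> nk; rewrite /ratio_exp /ratio_cst nk.
have kN : (k <= N.+1)%N by case/andP: (adm_k adm).
have sc m : (m < k)%N ->
    asymp (fun q => (scaled_c q m).[E q / root_scale q]) 0 ((-1) ^+ m).
  move=> mk; apply: cvg_asymp.
  have -> : (-1) ^+ m = (limit_c m).[1] by rewrite limit_c_lt// !hornerE.
  apply: (coef_cvg_horner _ (fun s => size_scaled_c s m) (size_limit_c m));
    last exact: hE.
  by apply: scaled_c_cvg; lia.
have s1 : (-1) ^+ n != 0 :> R by rewrite expf_neq0// oppr_eq0 oner_neq0.
have a1 := asympM (asympM (sc _ nk) (asympV s1 (sc n (ltnW nk))))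
  (asympV t2_neq0 (step_scale_asymp n.+1)).
apply: asymp_pos (asymp_eq a1 _ _) => [q q0||].
- rewrite !root_coef_scaled// /coef_scale big_nat_recr//= -/(coef_scale q n).
  have := step_scale_neq0 n.+1 q0; have := coef_scale_neq0 n q0.
  move: (coef_scale q n) (step_scale q n.+1) (scaled_c q n.+1).[_]
    (scaled_c q n).[_] => a b u v a0 b0.
  by rewrite !invfM invrK; move: v^-1 => w; field; rewrite b0 a0.
- rewrite /step_exp natrB; last by lia.
  by lra.
- by rewrite exprS mulfK// mulN1r.
Qed.

Lemma root_coef_rec (q : R) (n : nat) : 0 < q < 1 ->
  lead_rec p q n.+2 * root_coef n.+2 q =
  root_coef n.+1 q * (mid_rec p q n.+2).[E q]
  - low_rec p q n.+2 * root_coef n q.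
Proof.
move=> q01; have := c_rec (lead_neq0 q01 (ltn0Sn n.+1)); rewrite /root_coef.
move: (c p q n.+2) (c p q n.+1) (c p q n) => c2 c1 c0.
move=> /(congr1 (horner ^~ (E q))).
by rewrite hornerZ hornerD hornerN hornerM hornerZ.
Qed.

(** Two consecutive zeros of the recurrence would propagate down to
    [c_0 = 1]. *)
Lemma last_root_coef_neq0 : \forall q \near (0 : R)^'+, root_coef N q != 0.
Proof.
have [r /andP[r0 r1] rP] := root_continuous.
apply/near_right0P; exists r => // q qr; have [rE _] := rP q qr.
have q01 : 0 < q < 1.
  by case/andP: qr => -> qr /=; exact: lt_le_trans qr r1.
apply/eqP => CN.
have down n : (n <= N)%N ->
    root_coef (N - n)%N q = 0 /\ root_coef (N - n).+1 q = 0.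
  elim: n => [|n IHn] nN.
    by rewrite subn0; split => //; exact/rootP.
  have [c0 c1] := IHn (ltnW nN).
  have e : (N - n = (N - n.+1).+1)%N by lia.
  rewrite -e; split => //; rewrite e in c0 c1.
  have /eqP := root_coef_rec (N - n.+1)%N q01.
  rewrite c0 c1 mulr0 mul0r sub0r eq_sym oppr_eq0 mulf_eq0.
  by rewrite (negPf (low_neq0 q01 _)); [move=> /eqP|lia].
have [c0 _] := down N (leqnn _).
move/eqP: c0; rewrite subnn /root_coef /= hornerC.
by rewrite oner_eq0.
Qed.

Lemma mid_rec_root_asymp (m : nat) : (k < m)%N ->
  asymp (fun q => (mid_rec p q m).[E q]) (1 / 2 + h1 p) (t1 p).
Proof.
move=> km.
have aE : asymp E (3 / 2 - k%:R + h1 p - lambda1 p) (- t1 p).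
  apply: (@asymp_pos _ (fun q => root_scale q * (E q / root_scale q))).
    by move=> q q0; rewrite mulrC divfK ?root_scale_neq0.
  apply: (asymp_eq (asympM root_scale_asymp (cvg_asymp hE))).
    exact: addr0.
  exact: mulr1.
have aX := asympM (asymp_powR (m%:R - 1 + lambda1 p)) aE.
have := asympD_lt _ (mid_cst_asymp (leq_ltn_trans (leq0n k) km)) aX.
have km' : (k%:R : R) + 1 <= m%:R by rewrite natr1 ler_nat.
move=> /(_ ltac:(lra)); apply: asymp_pos => q _.
by rewrite mid_recE hornerD hornerZ hornerX hornerC addrC.
Qed.

(** From the index [k] on, the solution is followed backwards from
    [c_(N+1) = 0]: the term in [c_(m+2)] is negligible, so that the ratio is
    that of the two other coefficients of the recurrence. *)
Lemma ratio_asymp_backward (m : nat) (D : R) : (k <= m.+1)%N -> (m < N)%N ->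
  (\forall q \near (0 : R)^'+, root_coef m.+1 q != 0) ->
  asymp (fun q => root_coef m.+2 q / root_coef m.+1 q) (ratio_exp m.+1) D ->
  (\forall q \near (0 : R)^'+, root_coef m q != 0) /\
  asymp (fun q => root_coef m.+1 q / root_coef m q) (ratio_exp m) (t1 p)^-1.
Proof.
move=> km mN c1 aD.
have mk : (m.+1 < k)%N = false by lia.
have mk2 : (m.+2 < k)%N = false by lia.
pose W q := (mid_rec p q m.+2).[E q]
  - lead_rec p q m.+2 * (root_coef m.+2 q / root_coef m.+1 q).
have aW : asymp W (1 / 2 + h1 p) (t1 p).
  have am : asymp (fun q => (mid_rec p q m.+2).[E q]) _ _ :=
    mid_rec_root_asymp (m := m.+2) km.
  apply: asympD_lt am (asympN (asympM (lead_asymp _) aD)) => //.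
  have m0 : (0 : R) <= m%:R by [].
  by rewrite /ratio_exp mk2 -!natr1; have := adm_B adm; lra.
have aL : asymp (fun q => low_rec p q m.+2) _ _ := low_asymp (n := m.+2) mN.
have q01 : \forall q \near (0 : R)^'+, 0 < q < 1.
  by apply/near_right0P; exists 1.
have L0 := asymp_neq0 (oner_neq0 _) aL.
have W0 := asymp_neq0 t1_neq0 aW.
have key : \forall q \near (0 : R)^'+,
    [/\ root_coef m.+1 q * W q = low_rec p q m.+2 * root_coef m q,
        root_coef m.+1 q != 0, W q != 0 & low_rec p q m.+2 != 0].
  near=> q; have cq : root_coef m.+1 q != 0 by near: q.
  split => //; [|by near: q|by near: q].
  have q01q : 0 < q < 1 by near: q.
  have := root_coef_rec m q01q.
  rewrite /W mulrBr => e; rewrite [root_coef m.+1 q * (_ * _)]mulrCA.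
  by rewrite [root_coef m.+1 q * (_ / _)]mulrC divfK// e opprB addrC subrK.
split.
  apply: filterS key => q [e a b l]; apply: contra_neq (mulf_neq0 a b) => c0.
  by rewrite e c0 mulr0.
have aR := asympM aL (asympV t1_neq0 aW).
apply: asymp_near (asymp_eq aR _ _) => [||].
- apply: filterS key => q [e a b l].
  have c0 : root_coef m q != 0.
    by apply: contra_neq (mulf_neq0 a b) => c0; rewrite e c0 mulr0.
  by apply/eqP; rewrite eqr_div// e.
- rewrite /ratio_exp mk.
  have -> : m.+2%:R = m.+1%:R + 1 :> R by rewrite natr1.
  by lra.
- by rewrite mul1r.
Unshelve. all: by end_near. Qed.

Lemma ratio_asymp_ge (n : nat) : (k <= n.+1)%N -> (n < N)%N ->
  asymp (fun q => root_coef n.+1 q / root_coef n q) (ratio_exp n) (ratio_cst n).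
Proof.
move=> kn nN; rewrite /ratio_cst ltnNge kn /=.
(* Any constant can start the descent; as [c_(N+1)] vanishes, 0 will do. *)
have start : asymp (fun q => root_coef N.+1 q / root_coef N q) (ratio_exp N) 0.
  apply: (asymp_near (u := fun=> 0)).
    by apply: filterS hroot => q /rootP rE; rewrite /root_coef rE mul0r.
  by split; apply: cvg_near_cst; apply: nearW => q; rewrite mul0r.
have back i : (k <= (N - i.+1).+1)%N -> (i < N)%N ->
    (\forall q \near (0 : R)^'+, root_coef (N - i.+1)%N q != 0) /\
    asymp (fun q => root_coef (N - i.+1).+1 q / root_coef (N - i.+1)%N q)
      (ratio_exp (N - i.+1)) (t1 p)^-1.
  elim: i => [|i IHi] ki iN.
    have e : N = (N - 1).+1 by lia.
    apply: (ratio_asymp_backward (D := 0)) => //; first lia.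
      by rewrite -e; exact: last_root_coef_neq0.
    by rewrite -e.
  have [c0 a0] : _ := IHi ltac:(lia) ltac:(lia).
  have e : (N - i.+1 = (N - i.+2).+1)%N by lia.
  rewrite e in c0 a0; apply: ratio_asymp_backward c0 a0 => //; lia.
have e : n = (N - (N - n.+1).+1)%N by lia.
by rewrite e; apply: (back (N - n.+1)%N _ _).2; lia.
Qed.

Lemma ratio_asymp (n : nat) : (n < N)%N ->
  asymp (fun q => root_coef n.+1 q / root_coef n q) (ratio_exp n) (ratio_cst n).
Proof.
move=> nN; case: (ltnP n.+1 k) => nk; first exact: ratio_asymp_lt.
exact: ratio_asymp_ge.
Qed.

Lemma root_coef_asymp (n : nat) : (n <= N)%N ->
  asymp (root_coef n) (\sum_(0 <= i < n) ratio_exp i)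
    (\prod_(0 <= i < n) ratio_cst i).
Proof.
elim: n => [|n IHn] nN.
  rewrite !big_nil; apply: asymp_pos (asymp_cst 1) => q _.
  by rewrite /root_coef /= hornerC.
have an := IHn (ltnW nN).
have P0 := prod_seq_neq0 n ratio_cst_neq0.
rewrite !big_nat_recr//=.
apply: asymp_near (asympM an (ratio_asymp nN)).
by apply: filterS (asymp_neq0 P0 an) => q c0; rewrite mulrC divfK.
Qed.

Lemma sim_root_coef (n : nat) (u : R -> R) : (n < N)%N ->
  asymp u (ratio_exp n) (ratio_cst n) ->
  sim (root_coef n.+1) (fun q => u q * root_coef n q).
Proof.
move=> nN au.
apply: asymp_sim (prod_seq_neq0 n.+1 ratio_cst_neq0) (root_coef_asymp nN) _.
rewrite !big_nat_recr//= addrC mulrC.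
exact: asympM au (root_coef_asymp (ltnW nN)).
Qed.

Lemma coef_qHeun_poly (q : R) (n : nat) :
  (qHeun_poly p N q (E q))`_n = if (n <= N)%N then root_coef n q else 0.
Proof.
rewrite /qHeun_poly big_mkord coef_sum.
under eq_bigr do rewrite coefZ coefXn.
case: leqP => nN.
  rewrite (bigD1 (Ordinal (nN : (n < N.+1)%N)))//= eqxx mulr1 big1 ?addr0//.
  by move=> i; rewrite -val_eqE /= eq_sym => /negPf ->; rewrite mulr0.
rewrite big1// => i _; rewrite gtn_eqF ?mulr0//.
exact: leq_trans (ltn_ord i) nN.
Qed.

Lemma size_qHeun_poly (q : R) : (size (qHeun_poly p N q (E q)) <= N.+1)%N.
Proof. by apply/leq_sizeP => n nN; rewrite coef_qHeun_poly leqNgt nN. Qed.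

Lemma qHeun_poly_branch (j : nat) : (j < N)%N ->
  exists (r : R) (x : R -> R),
    [/\ 0 < r, forall q, 0 < q < r -> root (qHeun_poly p N q (E q)) (x q),
        {within `]0, r[, continuous x}
      & asymp x (- ratio_exp j) (- (ratio_cst j)^-1)].
Proof.
have [r r0 cC] := root_coef_continuous.
apply: newton_polygon_branch r0 _ _ ratio_cst_neq0 _ _.
- exact: size_qHeun_poly.
- move=> q qr n; rewrite coef_qHeun_poly.
  under eq_cvg do rewrite coef_qHeun_poly.
  by case: ifP => _; [exact: cC|exact: cvg_cst].
- move=> n nN; under eq_fun do rewrite coef_qHeun_poly nN.
  exact: root_coef_asymp.
- by move=> i j' /andP[ij _]; exact: ratio_exp_lt.
Qed.

End at_root.

End qHeun.

(** * Polynomial-type solutions of the q-Heun equation *)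

(** The equation applied to [x^(lambda1 + n)]: the coefficients of the three
    powers of [x] which occur are, up to a common factor, those of the
    recurrence. *)
Lemma qHeun_monomial (R : realType) (p : qHeun_params R) (q e x : R) (n : nat) :
  0 < q ->
  (x - q `^ (h1 p + 1 / 2) * t1 p) * (x - q `^ (h2 p + 1 / 2) * t2 p)
    * ((q `^ lambda1 p)^-1 * (q ^+ n)^-1)
  + q `^ (alpha1 p + alpha2 p)
    * (x - q `^ (l1 p - 1 / 2) * t1 p) * (x - q `^ (l2 p - 1 / 2) * t2 p)
    * (q `^ lambda1 p * q ^+ n)
  - ((q `^ alpha1 p + q `^ alpha2 p) * x ^+ 2 + e * x
     + q `^ ((h1 p + h2 p + l1 p + l2 p + alpha1 p + alpha2 p) / 2)
       * (q `^ (beta p / 2) + q `^ (- (beta p / 2))) * t1 p * t2 p)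
  = (q `^ lambda1 p * q ^+ n)^-1 *
    (low_rec p q n.+2 / q * x ^+ 2 - (mid_rec p q n.+1).[e] * x
     + lead_rec p q n * q).
Proof.
move=> q0.
have pD a b : q `^ (a + b) = q `^ a * q `^ b by exact: powRDpos.
have pn m : q `^ m%:R = q ^+ m by rewrite powR_mulrn// ltW.
have pw0 a : q `^ a != 0 by rewrite lt0r_neq0// powR_gt0.
pose y := q ^+ n; pose r := q `^ (1 / 2); pose L := q `^ lambda1 p.
pose A1 := q `^ alpha1 p; pose A2 := q `^ alpha2 p.
pose H1 := q `^ h1 p; pose H2 := q `^ h2 p.
pose L1 := q `^ l1 p; pose L2 := q `^ l2 p.
have q1 : q = q `^ 1 by rewrite powRr1// ltW.
have qE : q = r * r by rewrite -pD -splitr.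
(* The definition of [lambda1] eliminates the power [q^beta]. *)
have BV : (q `^ beta p)^-1 =
    L ^+ 2 * (A1 * A2) * (L1 * L2) / (H1 * H2 * q ^+ 2).
  rewrite [X in _ / (_ * X ^+ 2)]q1 !expr2 -!pD -!powRN -!pD.
  by congr (_ `^ _); rewrite /lambda1; lra.
have alg (a b K c d g gp gm lw md ld : R) :
    a = H1 * r -> b = H2 * r -> K = A1 * A2 -> c = L1 / r -> d = L2 / r ->
    g * gp = H1 * H2 * q / L -> g * gm = H1 * H2 * q / L / q `^ beta p ->
    lw = q * (1 - y * L * A1) * (1 - y * L * A2) ->
    md = y * L * e + (r * (H1 * t1 p + H2 * t2 p)
       + (L1 * t1 p + L2 * t2 p) * ((y * L) ^+ 2 * A1 * A2 / r)) ->
    ld = t1 p * t2 p * (H1 * H2) * (1 - y) * (1 - y / q `^ beta p) ->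
    (x - a * t1 p) * (x - b * t2 p) * (L^-1 * y^-1)
    + K * (x - c * t1 p) * (x - d * t2 p) * (L * y)
    - ((A1 + A2) * x ^+ 2 + e * x + g * (gp + gm) * t1 p * t2 p)
    = (L * y)^-1 * (lw / q * x ^+ 2 - md * x + ld * q).
  move=> -> -> -> -> -> G1 G2 -> -> ->; rewrite (mulrDr g) G1 G2 BV.
  have y0 : y != 0 by rewrite expf_neq0// lt0r_neq0.
  move: (pw0 (1 / 2)) (pw0 (lambda1 p)) (pw0 (alpha1 p)) (pw0 (alpha2 p))
    (pw0 (h1 p)) (pw0 (h2 p)) (pw0 (l1 p)) (pw0 (l2 p)) y0 qE.
  rewrite -/r -/L -/A1 -/A2 -/H1 -/H2 -/L1 -/L2.
  move: y r L A1 A2 H1 H2 L1 L2 {BV G1 G2}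
    => y r L A1 A2 H1 H2 L1 L2 r0 L0 A10 A20 H10 H20 L10 L20 y0 ->.
  by field; rewrite r0 L0 H10 H20 y0.
apply: alg.
- exact: pD.
- exact: pD.
- exact: pD.
- by rewrite pD powRN.
- by rewrite pD powRN.
- rewrite [X in _ * X / _]q1 -powRN -!pD; congr (_ `^ _).
  by rewrite /lambda1; lra.
- rewrite [X in _ * X / _ / _]q1 -!powRN -!pD; congr (_ `^ _).
  by rewrite /lambda1; lra.
- rewrite /low_rec; congr (_ * (1 - _) * (1 - _)).
    by rewrite /y -pn -!pD -addn2 natrD; congr (_ `^ _); lra.
  by rewrite /y -pn -!pD -addn2 natrD; congr (_ `^ _); lra.
- rewrite mid_recE hornerD hornerZ hornerX hornerC /mid_cst.
  congr (_ * _ + (_ + _ * _)).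
    by rewrite /y -pn -!pD -natr1; congr (_ `^ _); lra.
  by rewrite /y -pn expr2 -powRN -!pD -natr1; congr (_ `^ _); lra.
- rewrite /lead_rec; congr (_ * _ * _ * (1 - _)); first exact: pD.
  by rewrite pD pn powRN.
Qed.

(** The images of the monomials telescope by the recurrence; what remains
    contains [c_(N+1)], zero at [e], and [low_rec] at [N + 2], zero because
    [N + lambda1 + alpha1 = 0]. *)
Lemma root_qHeun_solution (R : realType) (p : qHeun_params R) (N k : nat)
    (q e : R) :
  admissible p N k -> 0 < q < 1 -> root (c p q N.+1) e ->
  qHeun_solution p q e (fun x => x `^ lambda1 p * (qHeun_poly p N q e).[x]).
Proof.
move=> adm q01 /rootP rE x x0; have /andP[q0 _] := q01.
have qn0 := lt0r_neq0 q0.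
rewrite (powRM _ (ltW x0)) ?invr_ge0 ?(ltW q0)// (powRM _ (ltW q0) (ltW x0)).
have -> : q^-1 `^ lambda1 p = (q `^ lambda1 p)^-1.
  by rewrite -powR_inv1 ?(ltW q0)// -powRrM mulN1r powRN.
pose a n := (c p q n).[e].
have fE z : (qHeun_poly p N q e).[z] = \sum_(0 <= n < N.+1) a n * z ^+ n.
  rewrite /qHeun_poly horner_sum; apply: eq_bigr => n _.
  by rewrite hornerZ hornerXn.
pose Lq := q `^ lambda1 p.
pose T n := a n * x ^+ n * ((Lq * q ^+ n)^-1 *
    (low_rec p q n.+2 / q * x ^+ 2 - (mid_rec p q n.+1).[e] * x
     + lead_rec p q n * q)).
set A := (x - _) * (x - _); set B := _ * (x - _) * (x - _).
set D := _ * x ^+ 2 + _ + _.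
suff sumT : \sum_(0 <= n < N.+1) T n = 0.
  transitivity (x `^ lambda1 p * \sum_(0 <= n < N.+1) T n);
    last by rewrite sumT mulr0.
  rewrite !fE.
  have -> : \sum_(0 <= n < N.+1) T n =
      A * Lq^-1 * (\sum_(0 <= n < N.+1) a n * (x / q) ^+ n)
      + B * Lq * (\sum_(0 <= n < N.+1) a n * (q * x) ^+ n)
      - D * (\sum_(0 <= n < N.+1) a n * x ^+ n).
    rewrite !mulr_sumr -big_split /= -sumrB; apply: eq_bigr => n _.
    rewrite /T -qHeun_monomial// -/A -/B -/D -/Lq !exprMn exprVn; ring.
  by rewrite -/Lq; ring.
have Lq0 : Lq != 0 by rewrite lt0r_neq0// powR_gt0.
have rec n : lead_rec p q n.+2 * a n.+2 =
    a n.+1 * (mid_rec p q n.+2).[e] - low_rec p q n.+2 * a n.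
  exact: (root_coef_rec adm (fun=> e)).
have rec1 : lead_rec p q 1 * a 1%N = (mid_rec p q 1).[e].
  have := c_rec1 (lead_neq0 adm q01 (ltn0Sn 0)); rewrite /a.
  move: (c p q 1) => c1 /(congr1 (horner ^~ e)).
  by rewrite hornerZ hornerM hornerC mul1r.
have tele n : \sum_(0 <= m < n.+1) T m =
    (Lq * q ^+ n)^-1 * (a n * (low_rec p q n.+2 / q) * x ^+ n.+2
                        - lead_rec p q n.+1 * a n.+1 * x ^+ n.+1).
  elim: n => [|n IHn].
    rewrite big_nat1 /T rec1 /a /= hornerC.
    have -> : lead_rec p q 0 = 0 by rewrite /lead_rec expr0 subrr mulr0 mul0r.
    by ring.
  rewrite big_nat_recr//= IHn /T rec !exprS.
  by field; rewrite qn0 Lq0 expf_neq0.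
rewrite tele /a rE mulr0 mul0r subr0.
have -> : low_rec p q N.+2 = 0.
  rewrite /low_rec (_ : N.+2%:R - 2 + lambda1 p + alpha1 p = 0).
    by rewrite powRr0 subrr mulr0 mul0r.
  by rewrite -addn2 natrD; have := adm_N adm; lra.
by rewrite !mul0r !mulr0 mul0r mulr0.
Qed.

(** * Asymptotics of the coefficients and zeros of the solution *)

Theorem theorem4p3 (R : realType) (p : qHeun_params R) (N k : nat) (E : R -> R)
  (hN : N%:R = - lambda1 p - alpha1 p)
  (hbeta : beta p < 1) (halpha : alpha2 p - alpha1 p < 1)
  (ht1 : 0 < t1 p) (ht2 : 0 < t2 p)
  (hh : h1 p < h2 p) (hl : l1 p < l2 p)
  (hA : 0 < 1 + h2 p - l2 p - beta p)
  (hB : 0 < 2 + 2 * h2 p - l1 p - l2 p - beta p)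
  (hk : (1 <= k <= N.+1)%N)
  (hroot : \forall q \near (0 : R)^'+, root (c p q N.+1) (E q))
  (hE : sim E (fun q => - q `^ (3 / 2 - k%:R + h1 p - lambda1 p) * t1 p)) :
  [/\ (\forall q \near (0 : R)^'+,
         qHeun_solution p q (E q)
           (fun x => x `^ lambda1 p * (qHeun_poly p N q (E q)).[x])) /\
      (forall n, (1 <= n <= k.-1)%N ->
         sim (fun q => (c p q n).[E q])
             (fun q => - q `^ (n%:R - k%:R + 1 / 2 - h2 p) * (t2 p)^-1
                       * (c p q n.-1).[E q])) /\
      (forall n, (k <= n <= N)%N ->
         sim (fun q => (c p q n).[E q])
             (fun q => q `^ (2 * n%:R + 1 / 2 + h2 p - l1 p - l2 p - beta p)
                       * (t1 p)^-1 * (c p q n.-1).[E q])),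
      poly_sim N
        (fun q => qHeun_poly p N q (E q))
        (fun q =>
           (\prod_(1 <= j < k)
              (1 - (q `^ (j%:R - k%:R + 1 / 2 - h2 p) * (t2 p)^-1) *: 'X))
           * \prod_(k <= j < N.+1)
              (1 + (q `^ (2 * j%:R + 1 / 2 + h2 p - l1 p - l2 p - beta p)
                    * (t1 p)^-1) *: 'X))
    & forall j, (1 <= j <= N)%N ->
        exists (qj : R) (x : R -> R),
          [/\ 0 < qj,
              forall q, 0 < q < qj -> root (qHeun_poly p N q (E q)) (x q),
              {within `]0, qj[, continuous x},
              ((j <= k.-1)%N ->
                 sim x (fun q => q `^ (j%:R - 1 / 2 + h2 p) * t2 p))
            & ((k <= j)%N ->
                 sim x (fun q =>
                   - q `^ (- 2 * j%:R - 1 / 2 - h2 p + l1 p + l2 p + beta p)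
                   * t1 p))]].
Proof.
have adm : admissible p N k by split.
have hE' : sim E (root_scale p k) by exact: hE.
have asL (j : nat) : (j.+1 < k)%N ->
    asymp (fun q => - q `^ (j.+1%:R - k%:R + 1 / 2 - h2 p) * (t2 p)^-1)
      (ratio_exp p k j) (ratio_cst p k j).
  move=> jk; rewrite /ratio_exp /ratio_cst jk.
  apply: (asymp_eq (asympM (asympN (asymp_powR _)) (asymp_cst (t2 p)^-1))).
    by rewrite addr0.
  by rewrite mulN1r.
have asG (j : nat) : (k <= j.+1)%N ->
    asymp (fun q => q `^ (2 * j.+1%:R + 1 / 2 + h2 p - l1 p - l2 p - beta p)
                    * (t1 p)^-1)
      (ratio_exp p k j) (ratio_cst p k j).
  move=> kj; rewrite /ratio_exp /ratio_cst ltnNge kj /=.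
  apply: (asymp_eq (asympM (asymp_powR _) (asymp_cst (t1 p)^-1))).
    by rewrite addr0.
  by rewrite mul1r.
have [k0 kN] := andP hk.
split; [split; [|split] | |].
- have q01 : \forall q \near (0 : R)^'+, 0 < q < 1.
    by apply/near_right0P; exists 1.
  by apply: filterS2 q01 hroot => q; exact: root_qHeun_solution adm.
- case=> [//|n] nk; apply: (sim_root_coef adm hroot hE') => //; first lia.
  by apply: asL; lia.
- case=> [|n] /andP[kn nN]; first by lia.
  by apply: (sim_root_coef adm hroot hE') => //; exact: asG.
- pose a (j : nat) (q : R) :=
    if (j.+1 < k)%N then - q `^ (j.+1%:R - k%:R + 1 / 2 - h2 p) * (t2 p)^-1
    else q `^ (2 * j.+1%:R + 1 / 2 + h2 p - l1 p - l2 p - beta p) * (t1 p)^-1.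
  have prodE q : (\prod_(1 <= j < k)
        (1 - (q `^ (j%:R - k%:R + 1 / 2 - h2 p) * (t2 p)^-1) *: 'X)
      * \prod_(k <= j < N.+1)
          (1 + (q `^ (2 * j%:R + 1 / 2 + h2 p - l1 p - l2 p - beta p)
                * (t1 p)^-1) *: 'X))
      = \prod_(0 <= j < N) (1 + a j q *: 'X) :> {poly R}.
    rewrite -[RHS](big_add1 _ _ 0 N.+1 predT (fun j => 1 + a j.-1 q *: 'X)).
    rewrite (big_cat_nat k0 kN) /=; congr (_ * _).
      apply: eq_big_nat => j /andP[j0 jk].
      by rewrite /a prednK// jk mulNr scaleNr.
    apply: eq_big_nat => j /andP[kj _].
    by rewrite /a prednK ?(leq_trans k0)// ltnNge kj.
  have aP j : (j < N)%N -> asymp (a j) (ratio_exp p k j) (ratio_cst p k j).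
    by move=> _; rewrite /a; case: ltnP => [/asL|/asG].
  have incr i j : (i < j < N)%N -> ratio_exp p k i < ratio_exp p k j.
    by move=> /andP[ij _]; exact: ratio_exp_lt adm _ _ ij.
  split.
    apply: nearW => q; rewrite prodE size_prod_linear.
    by split => //; exact: size_qHeun_poly.
  move=> n nN; apply: (asymp_sim _ (C := \prod_(0 <= i < n) ratio_cst p k i)
    (a := \sum_(0 <= i < n) ratio_exp p k i)).
  + by apply: prod_seq_neq0 => i; exact: ratio_cst_neq0 adm _.
  + under eq_fun do rewrite coef_qHeun_poly nN.
    exact: (root_coef_asymp adm hroot hE').
  + by under eq_fun do rewrite prodE; exact: prod_linear_coef_asymp.
- move=> j /andP[j0 jN].
  (* Below [k] the edges of the Newton polygon come in the reverse order. *)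
  pose i := if (j < k)%N then (k - j).-1 else j.-1.
  have iN : (i < N)%N.
    by rewrite /i; case: (ltnP j k) => _; clear -j0 jN k0 kN; lia.
  have [r [x [r0 rx cx ax]]] := qHeun_poly_branch adm hroot hE' iN.
  exists r, x; split => // jk.
  + have ij : i.+1 = (k - j)%N by rewrite /i ifT; lia.
    apply: asymp_sim _ ax _.
      by rewrite oppr_eq0 invr_eq0 (ratio_cst_neq0 adm).
    have kj : (k - j < k)%N by lia.
    rewrite /ratio_exp /ratio_cst ij kj.
    apply: (asymp_eq (asympM (asymp_powR _) (asymp_cst (t2 p)))).
      by rewrite natrB; [lra|lia].
    by rewrite invrN opprK invrK mul1r.
  + have ij : i.+1 = j by rewrite /i ifF; lia.
    apply: asymp_sim _ ax _.
      by rewrite oppr_eq0 invr_eq0 (ratio_cst_neq0 adm).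
    rewrite /ratio_exp /ratio_cst ij ltnNge jk /=.
    apply: (asymp_eq (asympM (asympN (asymp_powR _)) (asymp_cst (t1 p)))).
      by lra.
    by rewrite invrK mulN1r.
Qed.
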